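(* Let $R$ be a right Noetherian ring. The map $[T]\mapsto\mathcal{Y}_T$, where $\mathcal{Y}_T={}^{\perp}T\cap\mathrm{cogen}^*(T)$, is a well-defined one-to-one correspondence (bijection) between (a) the equivalence classes, under the relation $\sim$, of Wakamatsu tilting right $R$-modules; and (b) the resolving subcategories $\mathcal{C}$ of $\mathrm{mod}\text{-}R$ that possess an Ext-injective cogenerator $T$ and are maximal (with respect to inclusion) among the resolving subcategories of $\mathrm{mod}\text{-}R$ with the same Ext-injective cogenerator $T$.
   Context: Rings are associative with identity and modules are unitary. $\mathrm{mod}\text{-}R$ is the category of finitely generated right $R$-modules. Subcategories are understood to be full and closed under isomorphism. $\mathrm{add}(T)$ is the class of right $R$-modules isomorphic to a direct summand of a finite direct sum of copies of $T$. $\mathrm{gen}^*(T)$ is the class of right $R$-modules $M$ for which there is an exact sequence $\cdots\to T_1\xrightarrow{f_1}T_0\xrightarrow{f_0}M\to 0$ with all $T_i\in\mathrm{add}(T)$ and $\mathrm{Ext}^1_R(T,\mathrm{Ker} f_i)=0$ for all $i\ge 0$. $\mathrm{cogen}^*(T)$ is the class of right $R$-modules $M$ for which there is an exact sequence $0\to M\xrightarrow{f^{-1}}T^0\xrightarrow{f^0}T^1\xrightarrow{f^1}\cdots$ with all $T^i\in\mathrm{add}(T)$ and $\mathrm{Ext}^1_R(\mathrm{Coker} f^i,T)=0$ for all $i\ge -1$. ${}^{\perp}T=\{M:\mathrm{Ext}^i_R(M,T)=0\text{ for all }i\ge1\}$; for a class $\mathcal{C}$, $\mathcal{C}^{\perp}=\{M:\mathrm{Ext}^i_R(X,M)=0\text{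 for all }X\in\mathcal{C},i\ge1\}$. A right $R$-module $T$ is Wakamatsu tilting if $\mathrm{Ext}^i_R(T,T)=0$ for all $i\ge 1$, $T\in\mathrm{gen}^*(R)$ and $R_R\in\mathrm{cogen}^*(T)$. Invertible bimodules: an $(S,S')$-bimodule $P$ is invertible if $P\otimes_{S'}-:S'\text{-Mod}\to S\text{-Mod}$ is an equivalence of categories. Relation $\sim$: for right $R$-modules $T,T'$ with $S=\mathrm{End}(T_R)$, $S'=\mathrm{End}(T'_R)$, $T\sim T'$ iff there are invertible bimodules ${}_SP_{S'}$ and ${}_{S'}Q_S$ with $T\cong P\otimes_{S'}T'$ and $T'\cong Q\otimes_S T$ as right $R$-modules. This is an equivalence relation; $[T]$ is the class of $T$. A subcategory $\mathcal{C}$ of $\mathrm{mod}\text{-}R$ is resolving if it is closed under direct summands, extensions and kernels of epimorphisms and contains all finitely generated projective right $R$-modules. A module $T\in\mathcal{C}$ is an Ext-injective cogenerator for $\mathcal{C}$ if $T\in\mathcal{C}^{\perp}$ and for every $M\in\mathcal{C}$ there is an exact sequence $0\to M\to T'\to M'\to0$ with $T'\in\mathrm{add}(T)$ and $M'\in\mathcal{C}$. *)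

(* Defs.v *)
From HB Require Import structures.
From mathcomp Require Import all_boot all_order all_algebra.
From mathcomp Require Import boolp.

Set Implicit Arguments.
Unset Strict Implicit.
Unset Printing Implicit Defensive.

Import GRing.Theory.

Local Open Scope ring_scope.
Local Open Scope quotient_scope.

(* Right R-modules are left modules over the converse ring R^c, so that
   [r *: x] reads "x r"; [R^c^o : rmodType R] is the regular module R_R.
   Rings are [pzRingType]s: the zero ring is allowed (it occurs as End(0)). *)
Notation rmodType R := (lmodType R^c).

Section Modules.
Variable A : pzRingType.
Implicit Types M N P X : lmodType A.

Definition surj (T U : Type) (f : T -> U) := forall y, exists x, f x = y.

Definition mod_iso M N := exists f : {linear M -> N}, bijective f.

Definition exact M N P (f : {linear M -> N}) (g : {linear N -> P}) :=
  forall y, g y = 0 <-> exists x, f x = y.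

Definition short_exact M N P (f : {linear M -> N}) (g : {linear N -> P}) :=
  [/\ injective f, exact f g & surj g].

Definition direct_summand M X := exists N, mod_iso (M * N)%type X.

Definition fin_gen M := exists (n : nat) (g : 'I_n -> M),
  forall x, exists c : 'I_n -> A, x = \sum_i c i *: g i.

Definition projective P :=
  forall M N (g : {linear M -> N}) (h : {linear P -> N}), surj g ->
  exists k : {linear P -> M}, g \o k =1 h.

Section Kernel.
Variables (M N : lmodType A) (f : {linear M -> N}).

Definition ker_pred : {pred M} := [pred x | f x == 0].

Fact ker_submod_closed : submod_closed ker_pred.
Proof.
split=> [|a x y]; rewrite !inE ?linear0 // => /eqP fx /eqP fy.
by rewrite linearP fx fy scaler0 addr0.
Qed.

HB.instance Definition _ :=
  GRing.isSubmodClosed.Build A M ker_pred ker_submod_closed.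

Record ker := Ker { ker_val : M; _ : ker_val \in ker_pred }.

HB.instance Definition _ := [isSub for ker_val].
HB.instance Definition _ := [Choice of ker by <:].
HB.instance Definition _ := [SubChoice_isSubLmodule of ker by <:].
End Kernel.

Section Cokernel.
Variables (M N : lmodType A) (f : {linear M -> N}).

Definition im_pred : {pred N} := [pred y | `[< exists x, f x = y >]].

Fact im_submod_closed : submod_closed im_pred.
Proof.
split=> [|a x y]; first by apply/asboolP; exists 0; exact: linear0.
move=> /asboolP[u <-] /asboolP[v <-]; apply/asboolP.
by exists (a *: u + v); rewrite linearP.
Qed.

HB.instance Definition _ :=
  GRing.isSubmodClosed.Build A N im_pred im_submod_closed.

Definition coker := Quotient.quot im_pred.

HB.instance Definition _ := GRing.Zmodule.on coker.

Definition coker_pi (x : N) : coker := \pi_(Quotient.quot im_pred) x.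

Fact coker_ind (Q : coker -> Prop) : (forall x, Q (coker_pi x)) -> forall y, Q y.
Proof. by move=> Qpi; elim/quotW. Qed.

Fact coker_piP x y : (coker_pi x == coker_pi y) = (x - y \in im_pred).
Proof. by rewrite [RHS]Quotient.idealrBE. Qed.

Fact coker_piD x y : coker_pi (x + y) = coker_pi x + coker_pi y.
Proof. exact: Quotient.pi_add. Qed.

Definition coker_scale (a : A) (x : coker) : coker := coker_pi (a *: repr x).

Fact coker_scale_pi a x : coker_scale a (coker_pi x) = coker_pi (a *: x).
Proof.
apply/eqP; rewrite coker_piP -scalerBr rpredZ // -coker_piP.
by apply/eqP; exact: reprK.
Qed.

Fact coker_scaleA a b (x : coker) :
  coker_scale a (coker_scale b x) = coker_scale (a * b) x.
Proof.
by elim/coker_ind: x => x; rewrite [coker_scale b _]coker_scale_pi !coker_scale_pi scalerA.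
Qed.

Fact coker_scale1 : left_id 1 coker_scale.
Proof. by elim/coker_ind=> x; rewrite coker_scale_pi scale1r. Qed.

Fact coker_scaleDr : right_distributive coker_scale +%R.
Proof.
move=> a; elim/coker_ind=> x; elim/coker_ind=> y.
by rewrite -coker_piD !coker_scale_pi scalerDr coker_piD.
Qed.

Fact coker_scaleDl x : {morph coker_scale^~ x : a b / a + b}.
Proof.
by move=> a b; elim/coker_ind: x => x; rewrite !coker_scale_pi scalerDl coker_piD.
Qed.

HB.instance Definition _ := GRing.Zmodule_isLmodule.Build A coker
  coker_scaleA coker_scale1 coker_scaleDr coker_scaleDl.
End Cokernel.

(* ... -> C 1 -> C 0 -> M -> 0, with [res_d C i : C i.+1 -> C i] *)
Record resolution M := Resolution {
  res_obj :> nat -> lmodType A;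
  res_aug : {linear res_obj 0 -> M};
  res_d : forall i, {linear res_obj i.+1 -> res_obj i};
  res_aug_surj : surj res_aug;
  res_aug_exact : exact (res_d 0) res_aug;
  res_d_exact : forall i, exact (res_d i.+1) (res_d i)
}.

(* 0 -> M -> C 0 -> C 1 -> ..., with [cores_d C i : C i -> C i.+1] *)
Record coresolution M := Coresolution {
  cores_obj :> nat -> lmodType A;
  cores_aug : {linear M -> cores_obj 0};
  cores_d : forall i, {linear cores_obj i -> cores_obj i.+1};
  cores_aug_inj : injective cores_aug;
  cores_aug_exact : exact cores_aug (cores_d 0);
  cores_d_exact : forall i, exact (cores_d i) (cores_d i.+1)
}.

Definition cocycle M (P : resolution M) N n (f : {linear P n -> N}) :=
  f \o res_d P n =1 \0.

Definition coboundary M (P : resolution M) N n : {linear P n -> N} -> Prop :=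
  match n with
  | 0 => fun f => f =1 \0
  | k.+1 => fun f => exists g : {linear P k -> N}, f =1 g \o res_d P k
  end.

(* Ext^n_A(M, N) = 0, i.e. H^n(Hom_A(P, N)) = 0 for every projective resolution
   P of M *)
Definition Ext_zero n M N := forall P : resolution M,
  (forall i, projective (P i)) ->
  forall f : {linear P n -> N}, cocycle f -> coboundary f.

End Modules.

Fact linear_ext (A : pzRingType) (M N : lmodType A) (f g : {linear M -> N}) :
  f =1 g -> f = g.
Proof.
case: f g => f [[a] [b]] [g [[c] [d]]] /= /funext fg.
by subst g; rewrite (Prop_irrelevance a c) (Prop_irrelevance b d).
Qed.

Section Endomorphisms.
Variables (A : pzRingType) (T : lmodType A).

Definition endo := {linear T -> T}.

HB.instance Definition _ := gen_eqMixin endo.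
HB.instance Definition _ := gen_choiceMixin endo.

Implicit Types f g h : {linear T -> T}.

Definition endo_zero : endo := \0 : {linear T -> T}.
Definition endo_one : endo := idfun : {linear T -> T}.
Definition endo_opp (f : endo) : endo := \- (f : {linear T -> T}) : {linear T -> T}.
Definition endo_add (f g : endo) : endo :=
  (f : {linear T -> T}) \+ (g : {linear T -> T}) : {linear T -> T}.
Definition endo_mul (f g : endo) : endo :=
  (f : {linear T -> T}) \o (g : {linear T -> T}) : {linear T -> T}.

Fact endo_addA : associative endo_add.
Proof. by move=> f g h; apply: linear_ext => x /=; rewrite addrA. Qed.
Fact endo_addC : commutative endo_add.
Proof. by move=> f g; apply: linear_ext => x /=; rewrite addrC. Qed.
Fact endo_add0 : left_id endo_zero endo_add.
Proof. by move=> f; apply: linear_ext => x /=; rewrite add0r. Qed.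
Fact endo_addN : left_inverse endo_zero endo_opp endo_add.
Proof. by move=> f; apply: linear_ext => x /=; rewrite addNr. Qed.

HB.instance Definition _ :=
  GRing.isZmodule.Build endo endo_addA endo_addC endo_add0 endo_addN.

Fact endo_mulA : associative endo_mul.
Proof. by move=> f g h; apply: linear_ext. Qed.
Fact endo_mul1 : left_id endo_one endo_mul.
Proof. by move=> f; apply: linear_ext. Qed.
Fact endo_mulr1 : right_id endo_one endo_mul.
Proof. by move=> f; apply: linear_ext. Qed.
Fact endo_mulDl : left_distributive endo_mul +%R.
Proof. by move=> f g h; apply: linear_ext. Qed.
Fact endo_mulDr : right_distributive endo_mul +%R.
Proof. by move=> f g h; apply: linear_ext => x /=; rewrite linearD. Qed.

HB.instance Definition _ := GRing.Zmodule_isPzRing.Build endo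
  endo_mulA endo_mul1 endo_mulr1 endo_mulDl endo_mulDr.
End Endomorphisms.

(* (A, B)-bimodules: the right B-module structure is the carrier's, and the left
   action of A commutes with it. *)
Record bimod (A B : pzRingType) := Bimod {
  bimod_sort :> rmodType B;
  lact : A -> {linear bimod_sort -> bimod_sort};
  lact1 : lact 1 =1 id;
  lactM : forall a b, lact (a * b) =1 lact a \o lact b;
  lactD : forall a b, lact (a + b) =1 lact a \+ lact b
}.

Definition left_mod (A B : pzRingType) (P : bimod A B) : Type := P.

Section LeftMod.
Variables (A B : pzRingType) (P : bimod A B).

HB.instance Definition _ := GRing.Zmodule.on (left_mod P).

Definition left_scale (a : A) (x : left_mod P) : left_mod P := lact P a x.

Fact left_scaleA a b x : left_scale a (left_scale b x) = left_scale (a * b) x.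
Proof. by rewrite /left_scale lactM. Qed.
Fact left_scale1 : left_id 1 left_scale.
Proof. exact: lact1. Qed.
Fact left_scaleDr : right_distributive left_scale +%R.
Proof. by move=> a x y; rewrite /left_scale linearD. Qed.
Fact left_scaleDl x : {morph left_scale^~ x : a b / a + b}.
Proof. by move=> a b; rewrite /left_scale lactD. Qed.

HB.instance Definition _ := GRing.Zmodule_isLmodule.Build A (left_mod P)
  left_scaleA left_scale1 left_scaleDr left_scaleDl.

Definition right_scale (b : B) (x : left_mod P) : left_mod P :=
  (b : B^c) *: (x : P).

Fact right_scale_linear b : linear (right_scale b).
Proof.
move=> a x y; rewrite /right_scale scalerDr; congr (_ + _).
exact: esym (linearZZ (lact P a) _ _).
Qed.

HB.instance Definition _ b :=
  GRing.isLinear.Build A (left_mod P) (left_mod P) _ (right_scale b)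
    (right_scale_linear b).
End LeftMod.

(* End(T_R) acts on T on the left by evaluation. *)
Definition endo_bimod (R : pzRingType) (T : rmodType R) : bimod (endo T) R :=
  @Bimod (endo T) R T id (fun=> erefl) (fun _ _ _ => erefl) (fun _ _ _ => erefl).

(* P (x)_B M: formal sums of pairs modulo the bilinearity relations. *)
Section Tensor.
Variables (B : pzRingType) (P : rmodType B) (M : lmodType B).

Inductive tens_eq : seq (P * M) -> seq (P * M) -> Prop :=
| tens_refl s : tens_eq s s
| tens_sym s t : tens_eq s t -> tens_eq t s
| tens_trans s t u : tens_eq s t -> tens_eq t u -> tens_eq s u
| tens_cat s s' t t' : tens_eq s s' -> tens_eq t t' -> tens_eq (s ++ t) (s' ++ t')
| tens_comm s t : tens_eq (s ++ t) (t ++ s)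
| tens_zero m : tens_eq [:: (0, m)] [::]
| tens_addl p q m : tens_eq [:: (p + q, m)] [:: (p, m); (q, m)]
| tens_addr p m n : tens_eq [:: (p, m + n)] [:: (p, m); (p, n)]
| tens_bal p (b : B) m : tens_eq [:: ((b : B^c) *: p, m)] [:: (p, b *: m)].

Definition tens_rel s t := `[< tens_eq s t >].

Fact tens_rel_equiv : equiv_class_of tens_rel.
Proof.
split=> [s|s t|t s u]; first by apply/asboolP; exact: tens_refl.
  by apply/asboolP/asboolP; exact: tens_sym.
by move=> /asboolP st /asboolP tu; apply/asboolP; exact: tens_trans st tu.
Qed.

Canonical tens_rel_equiv_rel := EquivRelPack tens_rel_equiv.
Canonical tens_rel_encModRel := defaultEncModRel tens_rel.

Definition tensor := {eq_quot tens_rel}.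

HB.instance Definition _ := Choice.on tensor.

Definition tens_pi (s : seq (P * M)) : tensor := \pi_({eq_quot tens_rel}) s.
Definition tens_repr (x : tensor) : seq (P * M) := repr x.

Fact tens_reprK x : tens_pi (tens_repr x) = x.
Proof. exact: reprK. Qed.

Fact tens_piP s t : tens_pi s = tens_pi t <-> tens_eq s t.
Proof.
have E : (tens_pi s == tens_pi t) = tens_rel s t by exact: eqmodE.
split=> [st|st]; first by apply/asboolP; rewrite -[`[< _ >]]E st.
by apply/eqP; rewrite E; apply/asboolP.
Qed.

Definition tens_opp_seq (s : seq (P * M)) := [seq (- u.1, u.2) | u <- s].

Definition tens0 : tensor := tens_pi [::].
Definition tens_add (x y : tensor) : tensor :=
  tens_pi (tens_repr x ++ tens_repr y).
Definition tens_opp (x : tensor) : tensor :=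
  tens_pi (tens_opp_seq (tens_repr x)).

Fact tens_eq_repr s : tens_eq (tens_repr (tens_pi s)) s.
Proof. by apply/tens_piP; rewrite tens_reprK. Qed.

Fact tens_add_pi s t : tens_add (tens_pi s) (tens_pi t) = tens_pi (s ++ t).
Proof. by apply/tens_piP; apply: tens_cat; exact: tens_eq_repr. Qed.

Fact tens_addA : associative tens_add.
Proof.
move=> x y z; apply/tens_piP.
apply: tens_trans (tens_cat (tens_refl _) (tens_eq_repr _)) _; rewrite catA.
exact: tens_sym (tens_cat (tens_eq_repr _) (tens_refl _)).
Qed.
Fact tens_addC : commutative tens_add.
Proof. by move=> x y; apply/tens_piP; exact: tens_comm. Qed.
Fact tens_add0 : left_id tens0 tens_add.
Proof. by move=> x; rewrite -[x in LHS]tens_reprK tens_add_pi tens_reprK. Qed.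
Fact tens_addN : left_inverse tens0 tens_opp tens_add.
Proof.
move=> x; rewrite -[x in tens_add _ x]tens_reprK tens_add_pi; apply/tens_piP.
elim: (tens_repr x) => [|[p m] s IHs] /=; first exact: tens_refl.
apply: (@tens_trans _ ([:: (- p, m); (p, m)] ++ (s ++ tens_opp_seq s))).
  exact: (tens_cat (tens_refl [:: (- p, m)]) (tens_comm _ ((p, m) :: s))).
apply: (@tens_cat _ [::] _ [::]); last exact: tens_trans (tens_comm _ _) IHs.
apply: tens_trans (tens_zero m); apply: tens_sym.
by rewrite -(addNr p); exact: tens_addl.
Qed.

HB.instance Definition _ :=
  GRing.isZmodule.Build tensor tens_addA tens_addC tens_add0 tens_addN.

Definition pure (p : P) (m : M) : tensor := tens_pi [:: (p, m)].

Fact pureDl p q m : pure (p + q) m = pure p m + pure q m.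
Proof. by rewrite [RHS]tens_add_pi; apply/tens_piP; exact: tens_addl. Qed.

Fact pureDr p m n : pure p (m + n) = pure p m + pure p n.
Proof. by rewrite [RHS]tens_add_pi; apply/tens_piP; exact: tens_addr. Qed.

Fact tensor_ind (Q : tensor -> Prop) : Q 0 ->
  (forall p m x, Q x -> Q (pure p m + x)) -> forall x, Q x.
Proof.
move=> Q0 QD x; rewrite -(tens_reprK x); elim: (tens_repr x) => [//|[p m] s IHs].
have -> : tens_pi ((p, m) :: s) = pure p m + tens_pi s by rewrite [RHS]tens_add_pi.
exact: QD.
Qed.

End Tensor.

Section TensorMap.
Variables (B : pzRingType) (P P' : rmodType B) (M M' : lmodType B).
Variables (f : {linear P -> P'}) (g : {linear M -> M'}).

Definition tens_map_seq (s : seq (P * M)) := [seq (f u.1, g u.2) | u <- s].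

Fact tens_map_seq_eq s t :
  tens_eq s t -> tens_eq (tens_map_seq s) (tens_map_seq t).
Proof.
elim=> [u|u v _|u v w _ uv _|u u' v v' _ uu' _ vv'|u v|m|p q m|p m n|p b m] /=.
- exact: tens_refl.
- exact: tens_sym.
- exact: tens_trans.
- by rewrite /tens_map_seq !map_cat; exact: tens_cat.
- by rewrite /tens_map_seq !map_cat; exact: tens_comm.
- by rewrite linear0; exact: tens_zero.
- by rewrite linearD; exact: tens_addl.
- by rewrite linearD; exact: tens_addr.
- by rewrite !linearZ; exact: tens_bal.
Qed.

Definition tens_map (x : tensor P M) : tensor P' M' :=
  tens_pi (tens_map_seq (tens_repr x)).

Fact tens_map_pi s : tens_map (tens_pi s) = tens_pi (tens_map_seq s).
Proof. by apply/tens_piP/tens_map_seq_eq; exact: tens_eq_repr. Qed.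

Fact tens_map_pure p m : tens_map (pure p m) = pure (f p) (g m).
Proof. exact: tens_map_pi. Qed.

Fact tens_mapD x y : tens_map (x + y) = tens_map x + tens_map y.
Proof.
rewrite -(tens_reprK x) -(tens_reprK y) [_ + _]tens_add_pi.
by rewrite !tens_map_pi [RHS]tens_add_pi /tens_map_seq map_cat.
Qed.

Fact tens_map0 : tens_map 0 = 0.
Proof. exact: tens_map_pi [::]. Qed.
End TensorMap.

(* P (x)_B M with the left A-module structure coming from P *)
Section LeftTensor.
Variables (A B : pzRingType) (P : bimod A B) (M : lmodType B).

Definition ltensor : Type := tensor P M.

HB.instance Definition _ := GRing.Zmodule.on ltensor.

Definition ltensor_scale (a : A) : ltensor -> ltensor :=
  tens_map (lact P a) idfun.

Fact ltensor_scaleA a b x :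
  ltensor_scale a (ltensor_scale b x) = ltensor_scale (a * b) x.
Proof.
rewrite /ltensor_scale; elim/tensor_ind: x => [|p m x IHx]; first by rewrite !tens_map0.
by rewrite !tens_mapD IHx !tens_map_pure lactM.
Qed.
Fact ltensor_scale1 : left_id 1 ltensor_scale.
Proof.
rewrite /ltensor_scale; elim/tensor_ind=> [|p m x IHx]; first by rewrite tens_map0.
by rewrite tens_mapD IHx tens_map_pure lact1.
Qed.
Fact ltensor_scaleDr : right_distributive ltensor_scale +%R.
Proof. by move=> a x y; rewrite /ltensor_scale tens_mapD. Qed.
Fact ltensor_scaleDl x : {morph ltensor_scale^~ x : a b / a + b}.
Proof.
move=> a b; rewrite /ltensor_scale; elim/tensor_ind: x => [|p m x IHx].
  by rewrite !tens_map0 addr0.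
by rewrite !tens_mapD IHx !tens_map_pure lactD pureDl addrACA.
Qed.

HB.instance Definition _ := GRing.Zmodule_isLmodule.Build A ltensor
  ltensor_scaleA ltensor_scale1 ltensor_scaleDr ltensor_scaleDl.
End LeftTensor.

(* P (x)_B M with the right C-module structure coming from M *)
Section RightTensor.
Variables (B C : pzRingType) (P : rmodType B) (M : bimod B C).

Definition rtensor : Type := tensor P (left_mod M).

HB.instance Definition _ := GRing.Zmodule.on rtensor.

Definition rtensor_scale (c : C^c) : rtensor -> rtensor :=
  tens_map idfun (@right_scale B C M c).

Fact rtensor_scaleA c d x :
  rtensor_scale c (rtensor_scale d x) = rtensor_scale (c * d) x.
Proof.
rewrite /rtensor_scale; elim/tensor_ind: x => [|p m x IHx]; first by rewrite !tens_map0.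
rewrite !tens_mapD IHx !tens_map_pure; congr (pure _ _ + _).
exact: (@scalerA _ M).
Qed.
Fact rtensor_scale1 : left_id 1 rtensor_scale.
Proof.
rewrite /rtensor_scale; elim/tensor_ind=> [|p m x IHx]; first by rewrite tens_map0.
rewrite tens_mapD IHx tens_map_pure; congr (pure _ _ + _).
exact: (@scale1r _ M).
Qed.
Fact rtensor_scaleDr : right_distributive rtensor_scale +%R.
Proof. by move=> a x y; rewrite /rtensor_scale tens_mapD. Qed.
Fact rtensor_scaleDl x : {morph rtensor_scale^~ x : c d / c + d}.
Proof.
move=> c d; rewrite /rtensor_scale; elim/tensor_ind: x => [|p m x IHx].
  by rewrite !tens_map0 addr0.
rewrite !tens_mapD IHx !tens_map_pure addrACA -pureDr; congr (pure _ _ + _).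
exact: (@scalerDl _ M).
Qed.

HB.instance Definition _ := GRing.Zmodule_isLmodule.Build C^c rtensor
  rtensor_scaleA rtensor_scale1 rtensor_scaleDr rtensor_scaleDl.
End RightTensor.

Record mod_functor (A B : pzRingType) := ModFunctor {
  fobj :> lmodType A -> lmodType B;
  fmap : forall M N : lmodType A, {linear M -> N} -> {linear fobj M -> fobj N};
  fmap_id : forall M : lmodType A, fmap (idfun : {linear M -> M}) =1 id;
  fmap_comp : forall (M N K : lmodType A) (g : {linear N -> K}) (f : {linear M -> N}),
    fmap (g \o f : {linear M -> K}) =1 fmap g \o fmap f
}.

Definition id_functor (A : pzRingType) : mod_functor A A :=
  @ModFunctor A A id (fun M N f => f) (fun _ _ => erefl)
    (fun _ _ _ _ _ _ => erefl).

Section CompFunctor.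
Variables (A B C : pzRingType) (G : mod_functor B C) (F : mod_functor A B).

Fact comp_functor_id (M : lmodType A) :
  fmap G (fmap F (idfun : {linear M -> M})) =1 id.
Proof.
move=> x; rewrite (_ : fmap F _ = idfun) ?fmap_id //.
by apply: linear_ext => y; rewrite fmap_id.
Qed.

Fact comp_functor_comp (M N K : lmodType A)
    (g : {linear N -> K}) (f : {linear M -> N}) :
  fmap G (fmap F (g \o f : {linear M -> K})) =1
  fmap G (fmap F g) \o fmap G (fmap F f).
Proof.
move=> x; rewrite -fmap_comp; congr (fmap G _ x).
by apply: linear_ext => y; rewrite fmap_comp.
Qed.

Definition comp_functor : mod_functor A C :=
  @ModFunctor A C (fun M => G (F M)) (fun M N f => fmap G (fmap F f))
    comp_functor_id comp_functor_comp.
End CompFunctor.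

Definition nat_iso (A B : pzRingType) (F G : mod_functor A B) :=
  exists eta : forall M : lmodType A, {linear F M -> G M},
    (forall M, bijective (eta M)) /\
    (forall (M N : lmodType A) (f : {linear M -> N}), eta N \o fmap F f =1 fmap G f \o eta M).

Definition is_equivalence (A B : pzRingType) (F : mod_functor A B) :=
  exists G : mod_functor B A,
    nat_iso (comp_functor G F) (id_functor A) /\
    nat_iso (comp_functor F G) (id_functor B).

Section TensorFunctor.
Variables (A B : pzRingType) (P : bimod A B).

Definition tensor_fmap (M N : lmodType B) (f : {linear M -> N}) :
  ltensor P M -> ltensor P N := tens_map idfun f.

Fact tensor_fmap_linear (M N : lmodType B) (f : {linear M -> N}) : linear (tensor_fmap f).
Proof.
move=> a x y; rewrite /tensor_fmap tens_mapD; congr (_ + _).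
change (tens_map idfun f (tens_map (lact P a) idfun x) =
        tens_map (lact P a) idfun (tens_map idfun f x)).
elim/tensor_ind: x => [|p m x IHx]; first by rewrite !tens_map0.
by rewrite !tens_mapD IHx !tens_map_pure.
Qed.

HB.instance Definition _ (M N : lmodType B) (f : {linear M -> N}) :=
  GRing.isLinear.Build A (ltensor P M) (ltensor P N) _ (tensor_fmap f)
    (tensor_fmap_linear f).

Fact tensor_fmap_id (M : lmodType B) :
  tensor_fmap (idfun : {linear M -> M}) =1 id.
Proof.
rewrite /tensor_fmap; elim/tensor_ind=> [|p m x IHx]; first by rewrite tens_map0.
by rewrite tens_mapD IHx tens_map_pure.
Qed.

Fact tensor_fmap_comp (M N K : lmodType B)
    (g : {linear N -> K}) (f : {linear M -> N}) :
  tensor_fmap (g \o f : {linear M -> K}) =1 tensor_fmap g \o tensor_fmap f.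
Proof.
rewrite /tensor_fmap; elim/tensor_ind=> [|p m x IHx] /=; first by rewrite !tens_map0.
by rewrite !tens_mapD IHx /= !tens_map_pure.
Qed.

Definition tensor_functor : mod_functor B A :=
  @ModFunctor B A (fun M => ltensor P M)
    (fun M N f => tensor_fmap f : {linear ltensor P M -> ltensor P N})
    tensor_fmap_id tensor_fmap_comp.

Definition invertible := is_equivalence tensor_functor.
End TensorFunctor.

Section WakamatsuTilting.
Variable R : pzRingType.

(* [classical_sets.set] cannot be used here: its universe lies strictly below
   that of [lmodType]. *)
Definition mod_class := rmodType R -> Prop.

Implicit Types (T M X : rmodType R) (C K : mod_class).

Definition right_ideal (I : R -> Prop) :=
  [/\ I 0, forall x y, I x -> I y -> I (x + y) & forall x r, I x -> I (x * r)].

Definition right_noetherian := forall I : nat -> R -> Prop,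
  (forall n, right_ideal (I n)) -> (forall n x, I n x -> I n.+1 x) ->
  exists n, forall m, (n <= m)%N -> forall x, I m x <-> I n x.

Definition add T : mod_class :=
  fun M => exists n : nat, direct_summand M {ffun 'I_n -> T}.

Definition gen_star T : mod_class := fun M =>
  exists P : resolution M,
    [/\ forall i, add T (P i),
        Ext_zero 1 T (ker (res_aug P)) &
        forall i, Ext_zero 1 T (ker (res_d P i))].

Definition cogen_star T : mod_class := fun M =>
  exists P : coresolution M,
    [/\ forall i, add T (P i),
        Ext_zero 1 (coker (cores_aug P)) T &
        forall i, Ext_zero 1 (coker (cores_d P i)) T].

Definition left_perp T : mod_class :=
  fun M => forall i, (1 <= i)%N -> Ext_zero i M T.

Definition right_perp C : mod_class :=
  fun M => forall X i, C X -> (1 <= i)%N -> Ext_zero i X M.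

Definition wakamatsu_tilting T :=
  [/\ forall i, (1 <= i)%N -> Ext_zero i T T,
      gen_star R^c^o T & cogen_star T R^c^o].

Definition sim T T' :=
  exists (P : bimod (endo T) (endo T')) (Q : bimod (endo T') (endo T)),
    [/\ invertible P, invertible Q,
        mod_iso T (rtensor P (endo_bimod T')) &
        mod_iso T' (rtensor Q (endo_bimod T))].

Definition sim_class T : mod_class := fun T' => sim T T'.

(* subcategories of mod-R are full, hence given by their objects, and closed
   under isomorphism *)
Definition subcategory C :=
  (forall M, C M -> fin_gen M) /\ (forall M N, mod_iso M N -> C M -> C N).

Definition resolving C :=
  [/\ subcategory C,
      forall M X, direct_summand M X -> C X -> C M,
      forall (M N L : rmodType R) (f : {linear M -> N}) (g : {linear N -> L}),
        short_exact f g -> C M -> C L -> C N,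
      forall (M N : rmodType R) (f : {linear M -> N}),
        surj f -> C M -> C N -> C (ker f) &
      forall P : rmodType R, fin_gen P -> projective P -> C P].

Definition ext_injective_cogenerator C T :=
  [/\ C T, right_perp C T &
      forall M, C M -> exists (T' M' : rmodType R)
        (f : {linear M -> T'}) (g : {linear T' -> M'}),
        [/\ short_exact f g, add T T' & C M']].

Definition Y T : mod_class := fun M => left_perp T M /\ cogen_star T M.

Definition tilting_class K := exists2 T, wakamatsu_tilting T & K = sim_class T.

Definition maximal_resolving C :=
  resolving C /\ exists2 T, ext_injective_cogenerator C T &
    forall C', resolving C' -> ext_injective_cogenerator C' T ->
      (forall M, C M -> C' M) -> C' = C.
End WakamatsuTilting.

(* Main.v *)
From HB Require Import structures.
From mathcomp Require Import all_boot all_order all_algebra.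
From mathcomp Require Import boolp.
Require Import Defs.

Set Implicit Arguments.
Unset Strict Implicit.
Unset Printing Implicit Defensive.

Import GRing.Theory.

Local Open Scope ring_scope.

(** Idea.  Equivalence of modules is additive equivalence: T ~ T' holds iff T lies
in add T' and T' in add T, because an invertible bimodule is finitely generated
projective on the right, and conversely Hom(T', T) is invertible as soon as T
and T' generate the same additive class.

Y T is the largest class of modules M in the left Ext-perpendicular of T that
embed into a module of add T with cokernel again in the class.  Closure
properties of Y T therefore follow by coinduction: extensions by a horseshoe,
kernels of epimorphisms from the extension M/K -> X/K -> X/M, and summands because
if M + N embeds in X with cokernel L, then X/M + M is an extension of L by M + N.
The same principle shows that every resolving subcategory with Ext-injective
cogenerator T is contained in Y T, which gives maximality and surjectivity.
Finally Y T = Y T' forces an embedding of T into a module of add T' with cokernel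
in Y T to split, so T and T' are additively equivalent. *)

(** * Linear maps, kernels and cokernels *)

Section LinearMaps.
Variable A : pzRingType.
Implicit Types M N L K P Q X Y T V : lmodType A.

Lemma ex_linear M N (f : M -> N) : linear f -> exists g : {linear M -> N}, g =1 f.
Proof.
move=> fl; pose m := GRing.isLinear.Build A M N *:%R f fl.
by exists (HB.pack f m : {linear M -> N}).
Qed.

Lemma linear_ker0 M N (f : {linear M -> N}) :
  (forall x, f x = 0 -> x = 0) -> injective f.
Proof.
move=> f0 x y /eqP; rewrite -subr_eq0 -linearB => /eqP /f0 /eqP.
by rewrite subr_eq0 => /eqP.
Qed.

(** Two values over x differ by a value over 0, so the relation is single-valued. Maps whose values
    depend on chosen preimages are built this way. *)
Lemma graph_linear M N (G : M -> N -> Prop) :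
  (forall x, exists u, G x u) ->
  (forall a x y u v, G x u -> G y v -> G (a *: x + y) (a *: u + v)) ->
  (forall v, G 0 v -> v = 0) ->
  exists f : {linear M -> N}, forall x, G x (f x).
Proof.
move=> Gtot Glin G0; have [f fG] := choice Gtot.
have Guniq x u v : G x u -> G x v -> u = v.
  move=> /(Glin (-1) x x u v) h /h; rewrite scaleN1r addNr scaleN1r => /G0 /eqP.
  by rewrite addrC subr_eq0 => /eqP.
have [g gE] : exists g : {linear M -> N}, g =1 f.
  by apply: ex_linear => a x y; apply: Guniq (fG _) _; exact: Glin.
by exists g => x; rewrite gE.
Qed.

Lemma linear_lift X K Q (k : {linear K -> Q}) (f : {linear X -> Q}) :
  injective k -> (forall x, exists u, k u = f x) ->
  exists f' : {linear X -> K}, forall x, k (f' x) = f x.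
Proof.
move=> kI kf; apply: (@graph_linear _ _ (fun x u => k u = f x)) => // [a x y u v ku kv|v].
  by rewrite !linearP ku kv.
by rewrite linear0 -(linear0 k) => /kI.
Qed.

Lemma factor_surj N L T (g : {linear N -> L}) (f : {linear N -> T}) :
  surj g -> (forall x, g x = 0 -> f x = 0) ->
  exists f' : {linear L -> T}, forall x, f' (g x) = f x.
Proof.
move=> gS gf.
have [||v [x [/gf -> //]]|f' f'E] :=
  @graph_linear L T (fun y v => exists x, g x = y /\ f x = v).
- by move=> y; have [x <-] := gS y; exists (f x), x.
- by move=> a _ _ _ _ [x [<- <-]] [y [<- <-]]; exists (a *: x + y); rewrite !linearP.
exists f' => x; have [y [gxy <-]] := f'E (g x).
by apply/eqP; rewrite -subr_eq0 -linearB gf // linearB gxy subrr.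
Qed.

Lemma ker_short_exact M N (g : {linear M -> N}) :
  surj g -> exists k : {linear ker g -> M}, short_exact k g.
Proof.
move=> gS; have [k kE] := @ex_linear (ker g) M val (linearP _).
exists k; split=> // [x y|y].
  by rewrite !kE => /val_inj.
split=> [gy|[x <-]]; last by rewrite kE; apply/eqP; exact: (valP x).
have yK : y \in ker_pred g by rewrite inE gy.
by exists (Ker yK); rewrite kE.
Qed.

Lemma coker_proj M N (i : {linear M -> N}) :
  exists2 p : {linear N -> coker i}, exact i p & surj p.
Proof.
have [|p pE] := @ex_linear N (coker i) (@coker_pi _ _ _ i).
  by move=> a x y; rewrite coker_piD -coker_scale_pi.
exists p; last by elim/coker_ind => x; exists x; rewrite pE.
move=> y; rewrite -[0](linear0 p) !pE; split=> [/eqP|[x <-]].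
  by rewrite coker_piP subr0 => /asboolP.
by apply/eqP; rewrite coker_piP subr0; apply/asboolP; exists x.
Qed.

Lemma coker_short_exact M N (i : {linear M -> N}) :
  injective i -> exists p : {linear N -> coker i}, short_exact i p.
Proof. by move=> iI; have [p ip pS] := coker_proj i; exists p. Qed.

(** By exactness [g] embeds the cokernel of [f]. This cuts a coresolution into short exact sequences
    of its cokernels. *)
Lemma coker_induced M N L (f : {linear M -> N}) (g : {linear N -> L}) :
  exact f g -> exists (u : {linear coker f -> L}) (q : {linear L -> coker g}),
    short_exact u q.
Proof.
move=> fg; have [p fp pS] := coker_proj f; have [q gq qS] := coker_proj g.
have [|u uE] := factor_surj (f := g) pS; first by move=> x; rewrite fp fg.
exists u, q; split=> // [|y].
  by apply: linear_ker0 => y; have [x <-] := pS y; rewrite uE fg fp.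
rewrite gq; split=> [[x <-]|[x <-]]; first by exists (p x); rewrite uE.
by have [z <-] := pS x; exists z; rewrite uE.
Qed.

Lemma ex_pair M N L (f : {linear M -> N}) (g : {linear M -> L}) :
  exists h : {linear M -> (N * L)%type}, forall x, h x = (f x, g x).
Proof. by apply: ex_linear => a x y; rewrite !linearP. Qed.

Lemma ex_copair M N L (f : {linear M -> L}) (g : {linear N -> L}) :
  exists h : {linear (M * N)%type -> L}, forall x, h x = f x.1 + g x.2.
Proof.
by apply: ex_linear => a x y; rewrite !linearP scalerDr addrACA.
Qed.

Lemma projective_prod P Q :
  projective P -> projective Q -> projective (P * Q)%type.
Proof.
move=> Pp Qp M N g h gS.
have [j1 j1E] := ex_pair (idfun : {linear P -> P}) (\0 : {linear P -> Q}).
have [j2 j2E] := ex_pair (\0 : {linear Q -> P}) (idfun : {linear Q -> Q}).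
have [k1 k1E] := Pp M N g (h \o j1) gS.
have [k2 k2E] := Qp M N g (h \o j2) gS.
have [k kE] := ex_copair k1 k2; exists k => -[x y] /=.
rewrite kE linearD /= [g (k1 x)]k1E [g (k2 y)]k2E /= -linearD j1E j2E.
by congr (h (_, _)); rewrite /= ?addr0 ?add0r.
Qed.
End LinearMaps.

(** * Vanishing of Ext *)

Section Perp.
Variables (A : pzRingType) (T : lmodType A).
Implicit Types M N L K P Q X V : lmodType A.

(** Surjectivity of Hom(i, T). For the inclusion of a syzygy in a projective module it amounts to
    the vanishing of Ext^1(-, T) on the quotient. *)
Definition extends M N (i : {linear M -> N}) :=
  forall f : {linear M -> T}, exists f' : {linear N -> T}, forall x, f' (i x) = f x.

(* [eperp n X] says that Ext^i(X, T) = 0 for 1 <= i <= n. *)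
Fixpoint eperp n X : Prop :=
  if n is n'.+1 then
    exists K Q (k : {linear K -> Q}) (g : {linear Q -> X}),
      [/\ short_exact k g, projective Q, extends k & eperp n' K]
  else True.

(* [M] is a direct summand of [X + V] with [V] projective *)
Definition stable_retract M X :=
  exists (V : lmodType A) (a : {linear M -> X}) (b : {linear X -> M})
         (c : {linear M -> V}) (d : {linear V -> M}),
    projective V /\ forall x, b (a x) + d (c x) = x.

Lemma short_exact0 M N L (f : {linear M -> N}) (g : {linear N -> L}) x :
  short_exact f g -> g (f x) = 0.
Proof. by case=> _ fg _; apply/fg; exists x. Qed.

(* Replaces Schanuel's lemma in showing that [eperp] does not depend on the
   presentation. *)
Lemma stable_retract_syzygy M X K P (k : {linear K -> P}) (h : {linear P -> M})
    K' Q (k' : {linear K' -> Q}) (g : {linear Q -> X}) :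
  short_exact k h -> projective P -> short_exact k' g -> projective Q ->
  stable_retract M X -> extends k' -> extends k /\ stable_retract K K'.
Proof.
move=> kh Pp k'g Qp [V [a [b [c [d [Vp abcd]]]]]] k'E.
have [kI khE hS] := kh; have [k'I k'gE gS] := k'g.
have [al alE] := Pp _ _ g (a \o h) gS.
have [be beE] := Qp _ _ h (b \o g) hS.
have [ga gaE] := Vp _ _ h d hS.
have [al' al'E] : exists al' : {linear K -> K'}, forall x, k' (al' x) = al (k x).
  apply: (linear_lift (f := al \o k)) => // x; apply/k'gE.
  by rewrite [g _]alE /= (short_exact0 _ kh) linear0.
have [be' be'E] : exists be' : {linear K' -> K}, forall x, k (be' x) = be (k' x).
  apply: (linear_lift (f := be \o k')) => // x; apply/khE.
  by rewrite [h _]beE /= (short_exact0 _ k'g) linear0.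
(* Since b a + d c = id, this combination is killed by [h]. On [K] the identity becomes be' al' + de
   k, so [K] is a retract of K' + P. *)
have [de deE] : exists de : {linear P -> K}, forall x,
    k (de x) = x - be (al x) - ga (c (h x)).
  apply: (linear_lift (f := idfun \- (be \o al) \- (ga \o c \o h))) => // x.
  apply/khE; rewrite /= !linearB /= [h (be _)]beE [h (ga _)]gaE /= [g _]alE /=.
  by rewrite -addrA -opprD abcd subrr.
have idK x : be' (al' x) + de (k x) = x.
  apply: kI; rewrite linearD be'E al'E deE (short_exact0 _ kh) !linear0 addr0.
  by rewrite addrC subrK.
split; last by exists P, al', be', k, de.
move=> f; have [f1 f1E] := k'E (f \o be').
exists ((f1 \o al) \+ (f \o de)) => x /=.
by rewrite -al'E f1E /= -linearD idK.
Qed.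

(** Induction through syzygies: the cover of [X] together with [V] covers [M], and the kernel is a
    stable retract of [K]. The projective part allowed in [stable_retract] keeps the induction
    going. *)
Lemma eperp_stable_retract n M X : eperp n X -> stable_retract M X -> eperp n M.
Proof.
elim: n M X => [//|n IHn] M X [K [Q [k [g [kg Qp kE KE]]]]] MX.
have [V [a [b [c [d [Vp abcd]]]]]] := MX.
have [h hE] := ex_copair (b \o g) d.
have hS : surj h.
  move=> x; have [_ _ /(_ (a x)) [q qE]] := kg.
  by exists (q, c x); rewrite hE /= qE abcd.
have [j jh] := ker_short_exact hS.
have QVp := projective_prod Qp Vp.
have [jE KK] := stable_retract_syzygy jh QVp kg Qp MX kE.
by exists (ker h), (Q * V)%type, j, h; split=> //; exact: IHn KE KK.
Qed.

Lemma projective0 V : (forall x : V, x = 0) -> projective V.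
Proof.
move=> V0 M N g h _; exists (\0 : {linear V -> M}) => x.
by rewrite (V0 x) !linear0.
Qed.

Lemma retract_stable M X (a : {linear M -> X}) (b : {linear X -> M}) :
  cancel a b -> stable_retract M X.
Proof.
(* Functions on the empty type form the zero module. *)
move=> ab; pose V : lmodType A := {ffun 'I_0 -> A^o}.
exists V, a, b, \0, \0; split=> [|x /=]; last by rewrite ab addr0.
by apply: projective0 => x; apply/ffunP; case.
Qed.

Lemma stable_retract_refl M : stable_retract M M.
Proof. by apply: (@retract_stable _ _ idfun idfun). Qed.

(** Independence of the presentation: [M] is a stable retract of itself, so [stable_retract_syzygy]
    compares any two of its presentations. *)
Lemma eperp_pres n M K P (k : {linear K -> P}) (h : {linear P -> M}) :
  eperp n.+1 M -> short_exact k h -> projective P -> extends k /\ eperp n K.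
Proof.
move=> [K' [Q [k' [g [k'g Qp k'E K'E]]]]] kh Pp.
have [kE KK] := stable_retract_syzygy kh Pp k'g Qp (stable_retract_refl M) k'E.
by split=> //; exact: eperp_stable_retract K'E KK.
Qed.

Lemma eperp_projective n P : projective P -> eperp n P.
Proof.
elim: n P => [//|n IHn] P Pp; pose V : lmodType A := {ffun 'I_0 -> A^o}.
have V0 (x : V) : x = 0 by apply/ffunP; case.
exists V, P, \0, idfun; split=> //; last by apply: IHn; exact: projective0.
  split=> [x y _|y|y]; [by rewrite (V0 x) (V0 y)| |by exists y].
  by split=> [/= ->|[x <-]] //; exists 0.
by move=> f; exists \0 => x /=; rewrite (V0 x) linear0.
Qed.

(** The cover of [L] lifts to a map [Q -> N], and [N] is the pushout of [M] and [Q] along [K]. So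
    [f] extends to [N] once its composite with [mu] extends to [Q]. *)
Lemma eperp_extends M N L (i : {linear M -> N}) (p : {linear N -> L}) :
  eperp 1 L -> short_exact i p -> extends i.
Proof.
move=> [K [Q [k [g [kg Qp kE _]]]]] ip f.
have [iI ipE pS] := ip; have [kI kgE gS] := kg.
have [la laE0] := Qp _ _ p g pS.
have laE q : p (la q) = g q := laE0 q.
have [mu muE] : exists mu : {linear K -> M}, forall x, i (mu x) = la (k x).
  apply: (linear_lift (f := la \o k)) => // x; apply/ipE.
  by rewrite /= laE (short_exact0 _ kg).
have [ph phE] := kE (f \o mu).
(* Single-valued because i m + la q = 0 forces q = k x and m = - mu x for some x in [K]. *)
have [||v|f' f'E] := @graph_linear A N T (fun n v =>
  exists m q, n = i m + la q /\ v = f m + ph q).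
- move=> x; have [q qE] := gS (p x).
  have [|m mE] := (ipE (x - la q)).1; first by rewrite linearB laE qE subrr.
  by exists (f m + ph q), m, q; rewrite mE subrK.
- move=> a _ _ _ _ [m [q [-> ->]]] [m' [q' [-> ->]]].
  by exists (a *: m + m'), (a *: q + q'); split; rewrite !linearP !scalerDr addrACA.
- move=> [m [q [im ->]]].
  have [|x xE] := (kgE q).1.
    by have := congr1 p im; rewrite linearD (short_exact0 _ ip) add0r linear0 laE.
  have -> : m = - mu x.
    by apply: iI; apply/eqP; rewrite linearN -addr_eq0 muE xE -im.
  by rewrite -xE phE /= linearN addNr.
exists f' => x; have [m [q [ixE ->]]] := f'E (i x).
have [|y yE] := (kgE q).1.
  by have := congr1 p ixE; rewrite linearD !(short_exact0 _ ip) add0r laE.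
rewrite -yE phE /= -linearD; congr (f _); apply: iI.
by rewrite linearD muE yE.
Qed.

(** Horseshoe lemma: Q1 + Q2 covers [N], and the kernel is an extension of [K2] by [K1], to which
    the induction hypothesis applies. *)
Lemma eperp_extension n M N L (i : {linear M -> N}) (p : {linear N -> L}) :
  short_exact i p -> eperp n M -> eperp n L -> eperp n N.
Proof.
elim: n M N L i p => [//|n IHn] M N L i p ip.
move=> [K1 [Q1 [k1 [g1 [kg1 Q1p k1E K1E]]]]] [K2 [Q2 [k2 [g2 [kg2 Q2p k2E K2E]]]]].
have [iI ipE pS] := ip; have [k1I kg1E g1S] := kg1; have [k2I kg2E g2S] := kg2.
have [la laE0] := Q2p _ _ p g2 pS.
have laE q : p (la q) = g2 q := laE0 q.
have [h hE] := ex_copair (i \o g1) la.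
have hS : surj h.
  move=> x; have [q2 q2E] := g2S (p x).
  have [|m mE] := (ipE (x - la q2)).1.
    by rewrite linearB laE q2E subrr.
  have [q1 q1E] := g1S m.
  by exists (q1, q2); rewrite hE /= q1E mE subrK.
have [j jh] := ker_short_exact hS; have [jI jhE _] := jh.
have [u uE] : exists u : {linear K1 -> ker h}, forall x, j (u x) = (k1 x, 0).
  have [w wE] := ex_pair k1 (\0 : {linear K1 -> Q2}).
  have [|x|u uE] := @linear_lift _ _ _ _ j w; [exact: jI| |by exists u => x; rewrite uE wE].
  by apply/jhE; rewrite hE wE /= (short_exact0 _ kg1) !linear0 addr0.
have [v vE] : exists v : {linear ker h -> K2}, forall x, k2 (v x) = (j x).2.
  apply: (linear_lift (f := snd \o j)) => // x; apply/kg2E => /=.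
  have := congr1 p (hE (j x)).
  by rewrite (short_exact0 _ jh) linearD /= (short_exact0 _ ip) add0r linear0 laE.
have uv : short_exact u v.
  split=> [x y /(congr1 j)|y|y].
  - by rewrite !uE => -[/k1I].
  - split=> [vy|[x <-]]; last by apply: k2I; rewrite vE uE linear0.
    have jy2 : (j y).2 = 0 by rewrite -vE vy linear0.
    have [|x xE] := (kg1E (j y).1).1.
      apply: iI; rewrite linear0.
      by have := hE (j y); rewrite (short_exact0 _ jh) jy2 linear0 addr0 /=.
    by exists x; apply: jI; rewrite uE xE -jy2; case: (j y).
  - have [|m mE] := (ipE (- la (k2 y))).1.
      by rewrite linearN /= laE (short_exact0 _ kg2) oppr0.
    have [q qE] := g1S m.
    have [|z zE] := (jhE (q, k2 y)).1; first by rewrite hE /= qE mE addNr.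
    by exists z; apply: k2I; rewrite vE zE.
exists (ker h), (Q1 * Q2)%type, j, h; split=> //.
- exact: projective_prod.
(* Once the extension [f1] of the restriction to [K1] is subtracted, the rest factors through [K2]
   and extends to [Q2]. *)
- move=> f; have [f1 f1E] := k1E (f \o u).
  have [||f2 f2E] := @factor_surj _ _ _ _ v (f \- (f1 \o fst \o j)); first by case: uv.
    by case: uv => _ uvE _ x /uvE [y <-]; rewrite /= uE /= f1E /= subrr.
  have [f3 f3E] := k2E f2.
  have [f' f'E] := ex_copair f1 f3; exists f' => x.
  by rewrite f'E -vE f3E f2E /= addrC subrK.
- exact: IHn uv K1E K2E.
Qed.

(** The cover of [N] also covers [L], and the syzygy of [L] is then an extension of [M] by the
    syzygy of [N]. This allows dimension shifting. *)
Lemma syzygy_short_exact M N L (i : {linear M -> N}) (p : {linear N -> L})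
    K Q (k : {linear K -> Q}) (g : {linear Q -> N}) :
  short_exact i p -> short_exact k g ->
  exists (j : {linear ker (p \o g) -> Q}) (u : {linear K -> ker (p \o g)})
         (v : {linear ker (p \o g) -> M}),
    [/\ short_exact j (p \o g), short_exact u v,
        forall x, j (u x) = k x & forall x, i (v x) = g (j x)].
Proof.
move=> ip kg; have [iI ipE pS] := ip; have [kI kgE gS] := kg.
have pgS : surj (p \o g).
  by move=> x; have [y <-] := pS x; have [z <-] := gS y; exists z.
have [j jpg] := ker_short_exact pgS; have [jI jpgE _] := jpg.
have [u uE] : exists u : {linear K -> ker (p \o g)}, forall x, j (u x) = k x.
  apply: linear_lift => // x; apply/jpgE.
  by rewrite /= (short_exact0 _ kg) linear0.
have [v vE] : exists v : {linear ker (p \o g) -> M}, forall x, i (v x) = g (j x).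
  apply: (linear_lift (f := g \o j)) => // x; apply/ipE.
  exact: short_exact0 x jpg.
exists j, u, v; split=> //.
split=> [x y /(congr1 j)|y|y]; first by rewrite !uE => /kI.
  - split=> [vy|[x <-]].
      have [|x xE] := (kgE (j y)).1; first by rewrite -vE vy linear0.
      by exists x; apply: jI; rewrite uE.
    by apply: iI; rewrite vE uE (short_exact0 _ kg) linear0.
  - have [q qE] := gS (i y).
    have [|x xE] := (jpgE q).1; first by rewrite /= qE (short_exact0 _ ip).
    by exists x; apply: iI; rewrite vE xE.
Qed.

(** In the long exact sequence Ext^(j+1)(L, T) lies between Ext^j(M, T) and Ext^(j+1)(N, T). In the
    lowest degree [extends] makes the connecting map zero. *)
Lemma eperp_coker n M N L (i : {linear M -> N}) (p : {linear N -> L}) :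
  short_exact i p -> extends i -> eperp n M -> eperp n.+1 N -> eperp n.+1 L.
Proof.
move=> ip iE ME [K [Q [k [g [kg Qp kE KE]]]]].
have [j [u [v [jpg uv uE vE]]]] := syzygy_short_exact ip kg.
exists (ker (p \o g)), Q, j, (p \o g); split=> //.
- move=> f; have [f1 f1E] := kE (f \o u).
  have [||f2 f2E] := @factor_surj _ _ _ _ v (f \- (f1 \o j)); first by case: uv.
    by case: uv => _ uvE _ x /uvE [y <-]; rewrite /= uE f1E /= subrr.
  have [f3 f3E] := iE f2.
  exists (f1 \+ (f3 \o g)) => x /=.
  by rewrite -vE f3E f2E /= addrC subrK.
- exact: eperp_extension uv KE ME.
Qed.

(** [M] is the quotient of the syzygy of [L] by the syzygy of [N], so [eperp_coker] applies one
    degree lower. *)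
Lemma eperp_ker n M N L (i : {linear M -> N}) (p : {linear N -> L}) :
  short_exact i p -> eperp n N -> eperp n.+1 L -> eperp n M.
Proof.
case: n => [//|n] ip [K [Q [k [g [kg Qp kE KE]]]]] LE.
have [j [u [v [jpg uv uE vE]]]] := syzygy_short_exact ip kg.
have [jE KE'] := eperp_pres LE jpg Qp.
apply: eperp_coker uv _ KE KE' => f; have [f' f'E] := kE f.
by exists (f' \o j) => x; rewrite /= uE.
Qed.

End Perp.

(** * Finitely generated modules *)

Section FinGen.
Variable A : pzRingType.
Implicit Types M N L K P Q X V : lmodType A.

(** Lists, rather than families indexed by ordinals, let inductions remove one generator at a
    time. *)
Fixpoint spanned M (s : seq M) (x : M) : Prop :=
  if s is a :: s' then exists r y, x = r *: a + y /\ spanned s' y else x = 0.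

Definition fgen M := exists s : seq M, forall x, spanned s x.

Lemma spanP M (s : seq M) a x y : spanned s x -> spanned s y -> spanned s (a *: x + y).
Proof.
elim: s x y => [|b s IHs] x y /=; first by move=> -> ->; rewrite scaler0 addr0.
move=> [r [u [-> us]]] [t [v [-> vs]]].
exists (a * r + t), (a *: u + v); split; last exact: IHs.
by rewrite scalerDr scalerDl scalerA addrACA.
Qed.

Lemma span0 M (s : seq M) : spanned s 0.
Proof. by elim: s => //= a s IHs; exists 0, 0; rewrite scale0r addr0. Qed.

Lemma span_map M N (f : {linear M -> N}) (s : seq M) x :
  spanned s x -> spanned (map f s) (f x).
Proof.
elim: s x => [|a s IHs] x /=; first by move=> ->; rewrite linear0.
by move=> [r [y [-> ys]]]; exists r, (f y); rewrite linearP; split=> //; exact: IHs.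
Qed.

Lemma span_cat M (s t : seq M) x y : spanned s x -> spanned t y -> spanned (s ++ t) (x + y).
Proof.
elim: s x => [|a s IHs] x /=; first by move=> ->; rewrite add0r.
move=> [r [z [-> zs]]] yt; exists r, (z + y); rewrite addrA; split=> //.
exact: IHs.
Qed.

Lemma span_mem M (s : seq M) x : x \in s -> spanned s x.
Proof.
elim: s => //= a s IHs; rewrite inE => /orP[/eqP ->|/IHs xs].
  by exists 1, 0; rewrite scale1r addr0; split=> //; exact: span0.
by exists 0, x; rewrite scale0r add0r.
Qed.

Lemma fin_genP M : fin_gen M <-> fgen M.
Proof.
split=> [[n [g gE]]|[s sE]].
  exists [seq g i | i : 'I_n] => x; have [c ->] := gE x.
  elim/big_ind: _ => [|u v us vs|i _]; first exact: span0.
    by rewrite -(scale1r u); exact: spanP.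
  rewrite -[_ *: _]addr0; apply: spanP (span0 _); apply: span_mem.
  exact: image_f.
exists (size s), (fun i => nth 0 s i) => x.
have: spanned s x by []; elim: s {sE} x => [|a s IHs] x /=.
  by move=> ->; exists (fun=> 0); rewrite big_ord0.
move=> [r [y [-> /IHs [c ->]]]].
exists (fun i => if unlift ord0 i is Some j then c j else r).
rewrite big_ord_recl unlift_none /=; congr (_ + _).
by apply: eq_bigr => i _; rewrite liftK.
Qed.

Lemma fgen_surj M N (g : {linear M -> N}) : surj g -> fgen M -> fgen N.
Proof.
by move=> gS [s sE]; exists (map g s) => y; have [x <-] := gS y; exact: span_map.
Qed.

Lemma fgen_extension M N L (i : {linear M -> N}) (p : {linear N -> L}) :
  short_exact i p -> fgen M -> fgen L -> fgen N.
Proof.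
move=> [_ ipE pS] [s sE] [t tE]; have [q qE] := choice pS.
exists (map i s ++ map q t) => x.
suff [y [yt pyx]] : exists y, spanned (map q t) y /\ p y = p x.
  have [|z zE] := (ipE (x - y)).1; first by rewrite linearB pyx subrr.
  by rewrite -(subrK y x) -zE; apply: span_cat yt; exact: span_map.
elim: t (p x) {tE}(tE (p x)) => [|a t IHt] z /=.
  by move=> ->; exists 0; rewrite linear0.
move=> [r [y [-> /IHt [w [wt <-]]]]]; exists (r *: q a + w).
by rewrite linearP qE; split=> //; exists r, w.
Qed.

Lemma fgen_prod M N : fgen M -> fgen N -> fgen (M * N)%type.
Proof.
have [i iE] := ex_pair (idfun : {linear M -> M}) (\0 : {linear M -> N}).
apply: (@fgen_extension _ _ _ i snd); split=> [x y|[y1 y2]|y].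
- by rewrite !iE => -[].
- by split=> [/= ->|[x]]; [exists y1; rewrite iE|rewrite iE => -[_ <-]].
- by exists (0, y).
Qed.

(** Finite generation of left ideals; for the converse ring of [R] these are the right ideals of
    [R]. *)
Definition noetherian := forall I : A -> Prop, I 0 ->
  (forall a x y, I x -> I y -> I (a * x + y)) ->
  exists s : seq A, (forall x, x \in s -> I x) /\ forall x, I x -> @spanned A^o s x.

(** Induction on the generators: the coefficients of [a] in elements of [S] form a left ideal. Lifts
    of its generators reduce an element of [S] to one spanned by the remaining generators. *)
Lemma noetherian_sub M (s : seq M) (S : M -> Prop) : noetherian -> S 0 ->
  (forall a x y, S x -> S y -> S (a *: x + y)) ->
  (forall x, S x -> spanned s x) ->
  exists t : seq M, (forall x, x \in t -> S x) /\ forall x, S x -> spanned t x.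
Proof.
move=> nA; elim: s S => [|a s IHs] S S0 SP Ss.
  by exists [::]; split.
have [|b x y [x' [xs Sx]] [y' [ys Sy]]|u [uI uE]] :=
  nA (fun r : A => exists y, spanned s y /\ S (r *: a + y)).
- by exists 0; rewrite scale0r addr0; split=> //; exact: span0.
- exists (b *: x' + y'); split; first exact: spanP.
  have -> : (b * x + y : A) *: a + (b *: x' + y') = b *: (x *: a + x') + (y *: a + y').
    by rewrite scalerDl scalerDr addrACA -scalerA.
  exact: SP.
have [||x [Sx xs] //|t [tS tE]] := IHs (fun x => S x /\ spanned s x).
- by split=> //; exact: span0.
- by move=> b x y [Sx xs] [Sy ys]; split; [exact: SP|exact: spanP].
(* [w] consists of elements of [S] whose coefficients at [a] are the generators [u]. *)
have [w [wS wE]] : exists w : seq M, (forall x, x \in w -> S x) /\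
    forall r : A, @spanned A^o u r -> exists y,
      [/\ spanned s y, S (r *: a + y) & spanned w (r *: a + y)].
  elim: u uI {uE} => [|b u IHu] uI.
    exists [::]; split=> // r /= ->; exists 0.
    by rewrite scale0r addr0; split=> //; exact: span0.
  have [|w [wS wE]] := IHu; first by move=> x xu; apply: uI; rewrite inE xu orbT.
  have [y [ys Sy]] := uI b (mem_head _ _).
  exists (b *: a + y :: w); split.
    by move=> x; rewrite inE => /orP[/eqP ->|/wS].
  move=> _ /= [r [z0 [-> /wE [v [vs Sv wv]]]]]; pose z : A := z0.
  have E : (r * b + z : A) *: a + (r *: y + v) = r *: (b *: a + y) + (z *: a + v).
    by rewrite scalerDl scalerDr addrACA -scalerA.
  exists (r *: y + v); split; [exact: spanP|by rewrite E; exact: SP|].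
  by rewrite E; exists r, (z *: a + v).
exists (w ++ t); split=> [x|x Sx].
  by rewrite mem_cat => /orP[/wS|/tS []].
have [r [y [xE ys]]] := Ss x Sx.
have [|z [zs Sz wz]] := wE r; first by apply: uE; exists y; rewrite -xE.
rewrite -(subrK (r *: a + z) x) addrC; apply: span_cat => //; apply: tE; split.
  by rewrite addrC -scaleN1r; exact: SP.
by rewrite xE opprD addrACA subrr add0r addrC -scaleN1r; exact: spanP.
Qed.

Lemma fgen_inj M N (i : {linear M -> N}) :
  noetherian -> injective i -> fgen N -> fgen M.
Proof.
move=> nA iI [s sE].
have [|a _ _ [x <-] [y <-]|//|t [tS tE]] :=
  @noetherian_sub N s (fun y => exists x, i x = y) nA.
- by exists 0; rewrite linear0.
- by exists (a *: x + y); rewrite linearP.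
have [u uE] : exists u : seq M, t = map i u.
  elim: t tS {tE} => [|a t IHt] tS; first by exists [::].
  have [x xE] := tS a (mem_head _ _).
  have [|u uE] := IHt; first by move=> z zt; apply: tS; rewrite inE zt orbT.
  by exists (x :: u); rewrite /= xE uE.
exists u => x; have := tE (i x) (ex_intro _ x erefl); rewrite {}uE.
elim: u x => [|a u IHu] x /=; first by rewrite -(linear0 i) => /iI.
move=> [r [y [ixE yu]]]; exists r, (x - r *: a); rewrite addrC subrK; split=> //.
by apply: IHu; rewrite linearB ixE linearZ /= addrC addKr.
Qed.

Fixpoint free_module n : lmodType A :=
  if n is n'.+1 then (A^o * free_module n')%type else {ffun 'I_0 -> A^o}.

Lemma regular_map M (x : M) : exists f : {linear A^o -> M}, forall r : A, f r = r *: x.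
Proof. by apply: ex_linear => a r t; rewrite scalerDl scalerA. Qed.

Lemma projective_regular : projective A^o.
Proof.
move=> M N g h gS; have [x xE] := gS (h 1); have [k kE] := regular_map x.
exists k => r /=; rewrite kE linearZ /= xE -linearZ /=.
by congr (h _); rewrite /GRing.scale /= mulr1.
Qed.

Lemma projective_free n : projective (free_module n).
Proof.
elim: n => [|n IHn]; last exact: projective_prod projective_regular IHn.
by apply: projective0 => x; apply/ffunP; case.
Qed.

Lemma fgen_free n : fgen (free_module n).
Proof.
elim: n => [|n IHn]; first by exists [::] => x /=; apply/ffunP; case.
apply: fgen_prod IHn; exists [:: 1] => x; exists x, 0; rewrite addr0; split=> //.
by rewrite /GRing.scale /= mulr1.
Qed.

Lemma free_cover M : fgen M -> exists n (g : {linear free_module n -> M}), surj g.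
Proof.
move=> [s sE]; exists (size s).
suff [g gE] : exists g : {linear free_module (size s) -> M},
    forall x, spanned s x -> exists y, g y = x by exists g => x; exact: gE.
elim: s {sE} => [|a s [g gE]] /=.
  by exists \0 => x ->; exists 0.
have [f fE] := regular_map a; have [h hE] := ex_copair f g.
exists h => _ [r [y [-> /gE [z <-]]]]; exists (r, z).
by rewrite hE fE.
Qed.
End FinGen.

(** If no finite list generates [I], adjoining again and again an element outside the span gives a
    strictly increasing chain of right ideals. *)
Lemma right_noetherianP (R : pzRingType) : right_noetherian R -> noetherian R^c.
Proof.
move=> nR I I0 IP; apply: contrapT => nI.
(* The implication makes the choice total: a list not contained in [I] receives the dummy value
   0. *)
have next (s : seq R^c^o) : exists x, (forall y, y \in s -> I y) ->
    I x /\ ~ spanned s x.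
  have [sI|sI] := pselect (forall y, y \in s -> I y); last by exists 0.
  apply: contrapT => /forallNP nx; apply: nI; exists s; split=> // x Ix.
  by apply: contrapT => nsx; apply: (nx x).
have [f fE] := choice next.
pose S := fix S n := if n is n'.+1 then f (S n') :: S n' else [::].
have SI n : forall y, y \in S n -> I y.
  elim: n => [//|n IHn] y; rewrite inE => /orP[/eqP ->|/IHn //].
  by case: (fE _ IHn).
have [n|n x sx|n nE] := nR (fun n x => spanned (S n) x).
- split=> [|x y|x r]; first exact: span0.
    by move=> xS yS; have := spanP 1 xS yS; rewrite scale1r.
  by move=> xS; have := spanP (r : R^c) xS (span0 _); rewrite addr0.
- by exists 0, x; rewrite scale0r add0r.
have [_ []] := fE _ (SI n); apply/(nE n.+1 (leqnSn n)).
by apply: span_mem; rewrite mem_head.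
Qed.

(** * Resolutions *)

Section Resolutions.
Variable A : pzRingType.
Implicit Types M N L K P Q X V T : lmodType A.

Record presentation M := Presentation {
  pres_ker : lmodType A;
  pres_obj : lmodType A;
  pres_k : {linear pres_ker -> pres_obj};
  pres_g : {linear pres_obj -> M};
  pres_exact : short_exact pres_k pres_g }.

(** Presentations are chosen successively; [Z n] is the n-th syzygy, bundled with its proof of [D]
    so that the choice iterates. Each differential is a cover followed by a kernel inclusion. *)
Lemma resolution_of_step (D E : lmodType A -> Prop) :
  (forall M, D M -> exists p : presentation M, E (pres_obj p) /\ D (pres_ker p)) ->
  forall M, D M -> exists P : resolution M, forall i, E (P i).
Proof.
move=> step M DM; pose S := {X : lmodType A | D X}.
pose p (s : S) := sval (cid (step _ (svalP s))).
have pE s : E (pres_obj (p s)) /\ D (pres_ker (p s)) := svalP (cid (step _ (svalP s))).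
pose Z := fix Z n : S := if n is n'.+1 then exist _ _ (pE (Z n')).2 else exist _ M DM.
pose k n : {linear sval (Z n.+1) -> pres_obj (p (Z n))} := pres_k (p (Z n)).
pose g n : {linear pres_obj (p (Z n)) -> sval (Z n)} := pres_g (p (Z n)).
have kg n : short_exact (k n) (g n) := pres_exact (p (Z n)).
have ex n : forall y, g n y = 0 <-> exists x, k n (g n.+1 x) = y.
  have [kI kgE _] := kg n; have [_ _ gS] := kg n.+1.
  move=> y; split=> [/kgE [x <-]|[x <-]]; last by rewrite (short_exact0 _ (kg n)).
  by have [z <-] := gS x; exists z.
have dE n y : k n (g n.+1 y) = 0 <-> exists x, k n.+1 (g n.+2 x) = y.
  have [kI _ _] := kg n; rewrite -(ex n.+1) -{1}(linear0 (k n)).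
  by split=> [/kI|->].
pose P := @Resolution A M (fun n => pres_obj (p (Z n))) (g 0)
  (fun n => k n \o g n.+1 : {linear _ -> _})
  (let: And3 _ _ s := kg 0 in s) (ex 0) dE.
by exists P => i; case: (pE (Z i)).
Qed.

Definition has_resolution M :=
  exists P : resolution M, forall i, projective (P i).

Lemma fgen_free_resolution M : noetherian A -> fgen M ->
  exists P : resolution M, forall i, exists n, P i = free_module A n.
Proof.
move=> nA; apply: (resolution_of_step (E := fun Q => exists n, Q = free_module A n)) => {}M.
move=> /[dup] Mfg /free_cover [n [g gS]].
have [k kg] := ker_short_exact gS; have [kI _ _] := kg.
exists (Presentation kg); split; first by exists n.
exact: fgen_inj nA kI (fgen_free _ _).
Qed.

Lemma fgen_has_resolution M : noetherian A -> fgen M -> has_resolution M.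
Proof.
move=> nA /(fgen_free_resolution nA) [P PE]; exists P => i.
by have [n ->] := PE i; exact: projective_free.
Qed.

(** Dropping degree 0 of a resolution of [M] leaves a resolution of [K] with augmentation [h]. *)
Lemma truncate_aug M (P : resolution M) K (k : {linear K -> P 0}) :
  short_exact k (res_aug P) -> exists h : {linear P 1 -> K},
    [/\ forall x, k (h x) = res_d P 0 x, surj h & exact (res_d P 1) h].
Proof.
move=> kg; have [kI kgE _] := kg.
have [|h hE] := linear_lift (f := res_d P 0) kI.
  by move=> x; apply/kgE/res_aug_exact; exists x.
exists h; split=> // [y|y].
  have /res_aug_exact [x xE] := short_exact0 y kg.
  by exists x; apply: kI; rewrite hE.
rewrite -res_d_exact -hE; split=> [->|h0]; first by rewrite linear0.
by apply: kI; rewrite h0 linear0.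
Qed.

(** In degree 1 a cocycle factors through the syzygy, and [extends] makes it a coboundary; higher
    degrees follow by truncation. By [eperp_pres] this works in every projective resolution. *)
Lemma eperp_Ext n M T : eperp T n.+1 M -> Ext_zero n.+1 M T.
Proof.
elim: n M => [|n IHn] M ME P Pp f fE.
  have [k kg] := ker_short_exact (res_aug_surj P).
  have [kext _] := eperp_pres ME kg (Pp 0).
  have [h [hE hS hex]] := truncate_aug kg.
  have [|f1 f1E] := factor_surj (f := f) hS.
    by move=> x /hex [y <-]; exact: fE.
  by have [f2 f2E] := kext f1; exists f2 => x; rewrite /= -hE f2E f1E.
have [k kg] := ker_short_exact (res_aug_surj P).
have [_ KE] := eperp_pres ME kg (Pp 0).
have [h [hE hS hex]] := truncate_aug kg.
pose P' := @Resolution A _ (fun n => P n.+1) h (fun n => @res_d _ _ P n.+1) hS hex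
  (fun n => @res_d_exact _ _ P n.+1).
exact: (IHn _ KE P' (fun n => Pp n.+1) f fE).
Qed.

Section Splice.
Variables (M K Q : lmodType A) (k : {linear K -> Q}) (g : {linear Q -> M}).
Variables (kg : short_exact k g) (P : resolution K).

Definition splice_obj n : lmodType A := if n is n'.+1 then P n' else Q.

Definition splice_d n : {linear splice_obj n.+1 -> splice_obj n} :=
  match n with
  | 0 => k \o res_aug P : {linear P 0 -> Q}
  | n'.+1 => res_d P n'
  end.

Lemma splice_aug_exact : exact (splice_d 0) g.
Proof.
have [_ kgE _] := kg; move=> y; rewrite kgE.
split=> [[x <-]|[x <-]]; last by exists (res_aug P x).
by have [z <-] := res_aug_surj P x; exists z.
Qed.

Lemma splice_d_exact n : exact (splice_d n.+1) (splice_d n).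
Proof.
case: n => [|n]; last exact: res_d_exact.
have [kI _ _] := kg; move=> y; rewrite -res_aug_exact -{1}(linear0 k).
by split=> [/kI|/= ->].
Qed.

Definition splice : resolution M :=
  @Resolution A M splice_obj g splice_d (let: And3 _ _ s := kg in s)
    splice_aug_exact splice_d_exact.
End Splice.

(** [Ext_zero] ranges over projective resolutions, so one has to be produced: a free cover of [M]
    spliced with a resolution of its finitely generated kernel. *)
Lemma Ext_eperp n M T : noetherian A -> fgen M ->
  (forall i, (0 < i <= n)%N -> Ext_zero i M T) -> eperp T n M.
Proof.
move=> nA; elim: n M => [//|n IHn] M Mfg ME.
have [m [g gS]] := free_cover Mfg; have [k kg] := ker_short_exact gS.
have Kfg : fgen (ker g).
  by case: kg => kI _ _; exact: fgen_inj nA kI (fgen_free _ _).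
have splice_proj (P : resolution (ker g)) :
    (forall i, projective (P i)) -> forall i, projective (splice kg P i).
  by move=> Pp [|i]; [exact: projective_free|exact: Pp].
exists (ker g), (free_module A m), k, g; split=> //; first exact: projective_free.
  move=> f; have [P Pp] := fgen_has_resolution nA Kfg.
  (* A map on the syzygy composed with the augmentation is a 1-cocycle; being a coboundary means
     that [f] extends along [k]. *)
  have [||f' f'E] := ME 1 isT (splice kg P) _ (f \o res_aug P); first exact: splice_proj.
    move=> x /=; rewrite (_ : res_aug P _ = 0) ?linear0 //.
    by apply/res_aug_exact; exists x.
  by exists f' => y; have [x <-] := res_aug_surj P y; rewrite [RHS]f'E.
apply: IHn => // -[//|i] iE P Pp f fE.
exact: (ME i.+2 iE (splice kg P) (splice_proj P Pp) f fE).
Qed.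

Lemma left_perp_eperp M T : noetherian A -> fgen M ->
  (forall i, (1 <= i)%N -> Ext_zero i M T) <-> forall n, eperp T n M.
Proof.
move=> nA Mfg; split=> [ME n|ME [//|i] _]; last exact: eperp_Ext.
by apply: Ext_eperp => // i /andP[i0 _]; exact: ME.
Qed.

Record copresentation M := Copresentation {
  copres_obj : lmodType A;
  copres_coker : lmodType A;
  copres_i : {linear M -> copres_obj};
  copres_p : {linear copres_obj -> copres_coker};
  copres_exact : short_exact copres_i copres_p }.

Lemma coker_stable_retract M N L (i : {linear M -> N}) (p : {linear N -> L}) :
  exact i p -> surj p -> stable_retract (coker i) L.
Proof.
move=> ip pS; have [q iq qS] := coker_proj i.
have q0 y : q y = 0 <-> p y = 0 by rewrite iq ip.
have [a aE] := factor_surj (f := p) qS (fun x => (q0 x).1).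
have [b bE] := factor_surj (f := q) pS (fun x => (q0 x).2).
apply: (@retract_stable _ _ _ a b) => y; have [x <-] := qS y.
by rewrite aE bE.
Qed.

(** Dual to [resolution_of_step]. The cokernels of the spliced maps are the chosen ones only up to
    isomorphism, so [F] is carried over along stable retracts. *)
Lemma coresolution_of_step (D E F : lmodType A -> Prop) :
  (forall M, D M -> exists p : copresentation M,
     [/\ E (copres_obj p), F (copres_coker p) & D (copres_coker p)]) ->
  (forall M N, stable_retract N M -> F M -> F N) ->
  forall M, D M -> exists P : coresolution M,
    [/\ forall i, E (P i), F (coker (cores_aug P)) & forall i, F (coker (cores_d P i))].
Proof.
move=> step Fr M DM; pose S := {X : lmodType A | D X}.
pose p (s : S) := sval (cid (step _ (svalP s))).
have pE s : [/\ E (copres_obj (p s)), F (copres_coker (p s)) & D (copres_coker (p s))].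
  exact: svalP (cid (step _ (svalP s))).
have pD s : D (copres_coker (p s)) by case: (pE s).
pose Z := fix Z n : S := if n is n'.+1 then exist _ _ (pD (Z n')) else exist _ M DM.
pose k n : {linear sval (Z n) -> copres_obj (p (Z n))} := copres_i (p (Z n)).
pose g n : {linear copres_obj (p (Z n)) -> sval (Z n.+1)} := copres_p (p (Z n)).
have kg n : short_exact (k n) (g n) := copres_exact (p (Z n)).
have ex n : exact (k n) (k n.+1 \o g n).
  have [_ kgE _] := kg n; have [kI _ _] := kg n.+1.
  by move=> y; rewrite -kgE /= -{1}(linear0 (k n.+1)); split=> [/kI|->].
have dE n : exact (k n.+1 \o g n) (k n.+2 \o g n.+1).
  have [_ _ gS] := kg n => y; rewrite (ex n.+1).
  by split=> [[x <-]|[x <-]]; [have [z <-] := gS x; exists z|exists (g n x)].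
have exg n : exact (k n.+1 \o g n) (g n.+1).
  have [_ kgE _] := kg n.+1; have [_ _ gS] := kg n => y; rewrite kgE.
  by split=> [[x <-]|[x <-]]; [have [z <-] := gS x; exists z|exists (g n x)].
pose P := @Coresolution A M (fun n => copres_obj (p (Z n))) (k 0)
  (fun n => k n.+1 \o g n : {linear _ -> _})
  (let: And3 s _ _ := kg 0 in s) (ex 0) dE.
exists P; split=> [i||i]; first by case: (pE (Z i)).
  have [_ kgE gS] := kg 0.
  by apply: Fr (coker_stable_retract kgE gS) _; case: (pE (Z 0)).
have [_ _ gS] := kg i.+1.
by apply: Fr (coker_stable_retract (exg i) gS) _; case: (pE (Z i.+1)).
Qed.
End Resolutions.

(** * The class Y *)

Section Summands.
Variable A : pzRingType.
Implicit Types M N L K P Q X V T : lmodType A.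

Lemma linear_bijective M N (e : {linear M -> N}) : injective e -> surj e -> bijective e.
Proof. by move=> eI eS; have [g gE] := choice eS; exists g => // x; apply: eI. Qed.

Lemma linear_inverse M N (e : {linear M -> N}) :
  bijective e -> exists2 e' : {linear N -> M}, cancel e e' & cancel e' e.
Proof.
case=> g eg ge; have [|g' g'E] := @ex_linear _ N M g.
  by move=> a x y; apply: (can_inj eg); rewrite linearP !ge.
by exists g' => x; rewrite g'E ?eg ?ge.
Qed.

Lemma retract_summand M X (a : {linear M -> X}) (b : {linear X -> M}) :
  cancel a b -> mod_iso (M * ker b)%type X.
Proof.
move=> ab; have bS : surj b by move=> x; exists (a x).
have [k kb] := ker_short_exact bS; have [kI kbE _] := kb.
have [e eE] := ex_copair a k; exists e; apply: linear_bijective.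
  move=> [x n] [y m]; rewrite !eE /= => E.
  have := congr1 b E; rewrite !linearD !(short_exact0 _ kb) !addr0 !ab => xy.
  by move: E; rewrite xy => /addrI /kI ->.
move=> x; have [|n nE] := (kbE (x - a (b x))).1; first by rewrite linearB ab subrr.
by exists (b x, n); rewrite eE /= nE addrC subrK.
Qed.

(* [M] lies in add T: its identity is a finite sum of maps factoring through T *)
Definition finsummand T M :=
  exists s : seq ({linear M -> T} * {linear T -> M}),
    forall x, \sum_(u <- s) u.2 (u.1 x) = x.

Lemma finsummand_refl T : finsummand T T.
Proof.
by exists [:: (idfun : {linear T -> T}, idfun : {linear T -> T})] => x; rewrite big_seq1.
Qed.

Lemma finsummand_zero T M : (forall x : M, x = 0) -> finsummand T M.
Proof. by move=> M0; exists [::] => x; rewrite big_nil [RHS]M0. Qed.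

Lemma finsummand_retract T M X (a : {linear M -> X}) (b : {linear X -> M}) :
  cancel a b -> finsummand T X -> finsummand T M.
Proof.
move=> ab [s sE].
pose F (u : {linear X -> T} * {linear T -> X}) :=
  (u.1 \o a : {linear M -> T}, b \o u.2 : {linear T -> M}).
exists (map F s) => x.
by rewrite big_map -[RHS]ab -[a x in RHS]sE linear_sum.
Qed.

Lemma finsummand_prod T M N : finsummand T M -> finsummand T N -> finsummand T (M * N)%type.
Proof.
move=> [s sE] [t tE].
have [i iE] := ex_pair (idfun : {linear M -> M}) (\0 : {linear M -> N}).
have [j jE] := ex_pair (\0 : {linear N -> M}) (idfun : {linear N -> N}).
pose F (u : {linear M -> T} * {linear T -> M}) :=
  (u.1 \o fst : {linear (M * N)%type -> T}, i \o u.2 : {linear T -> (M * N)%type}).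
pose G (u : {linear N -> T} * {linear T -> N}) :=
  (u.1 \o snd : {linear (M * N)%type -> T}, j \o u.2 : {linear T -> (M * N)%type}).
exists (map F s ++ map G t).
move=> [x y]; rewrite big_cat !big_map /= -!linear_sum sE tE iE jE /=.
by congr (_, _); rewrite /= ?addr0 ?add0r.
Qed.

Lemma finsummand_trans T U M : finsummand U T -> finsummand T M -> finsummand U M.
Proof.
move=> [s sE] [t tE].
pose F (u : {linear M -> T} * {linear T -> M}) (v : {linear T -> U} * {linear U -> T}) :=
  (v.1 \o u.1 : {linear M -> U}, u.2 \o v.2 : {linear U -> M}).
exists [seq F u v | u <- t, v <- s] => x.
rewrite big_allpairs_dep -[RHS]tE; apply: eq_bigr => u _ /=.
by rewrite -[u.1 x in RHS]sE linear_sum.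
Qed.

Lemma finsummand_ind (C : lmodType A -> Prop) T :
  (forall M, (forall x : M, x = 0) -> C M) ->
  (forall M N, C M -> C N -> C (M * N)%type) ->
  (forall M X (a : {linear M -> X}) (b : {linear X -> M}), cancel a b -> C X -> C M) ->
  C T -> forall M, finsummand T M -> C M.
Proof.
move=> C0 CM Cr CT M [s sE].
(* The induction runs over partial sums of the identity, each factoring through a module of [C];
   only the full sum makes [M] a retract. *)
suff [X [a [b [CX abE]]]] : exists X (a : {linear M -> X}) (b : {linear X -> M}),
    C X /\ forall x, b (a x) = \sum_(u <- s) u.2 (u.1 x).
  by apply: (Cr _ _ a b) CX => x; rewrite abE sE.
elim: s {sE} => [|u s [X [a [b [CX abE]]]]].
  pose V : lmodType A := {ffun 'I_0 -> A^o}.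
  exists V, \0, \0; split=> [|x]; last by rewrite big_nil.
  by apply: C0 => x; apply/ffunP; case.
have [a' a'E] := ex_pair u.1 a; have [b' b'E] := ex_copair u.2 b.
exists (T * X)%type, a', b'; split; first exact: CM.
by move=> x; rewrite a'E b'E /= abE big_cons.
Qed.

Lemma summand_finsummand n T M : direct_summand M {ffun 'I_n -> T} -> finsummand T M.
Proof.
move=> [N [f /linear_inverse [g fg gf]]].
have [i iE] := ex_pair (idfun : {linear M -> M}) (\0 : {linear M -> N}).
have pE j : exists p : {linear M -> T}, forall x, p x = f (i x) j.
  by apply: ex_linear => a x y; rewrite !linearP !ffunE.
have qE j : exists q : {linear T -> M},
    forall x, q x = (g [ffun l => if l == j then x else 0]).1.
  apply: ex_linear => a x y.
  rewrite (_ : [ffun l => _] = a *: [ffun l => if l == j then x else 0] +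
                               [ffun l => if l == j then y else 0]) ?linearP //.
  by apply/ffunP => l; rewrite !ffunE; case: eqP => // _; rewrite scaler0 addr0.
have [p {}pE] := choice pE; have [q {}qE] := choice qE.
exists [seq (p j, q j) | j <- enum 'I_n] => x.
rewrite big_map big_enum /=.
have -> : \sum_j q j (p j x) = (g (f (i x))).1; last by rewrite fg iE.
under eq_bigr do rewrite qE pE.
rewrite -(raddf_sum fst) -linear_sum; congr (g _).1; apply/ffunP => l.
rewrite sum_ffunE (bigD1 l) //= ffunE eqxx big1 ?addr0 // => j jl.
by rewrite ffunE eq_sym (negPf jl).
Qed.

Lemma finsummand_summand T M : finsummand T M -> exists n, direct_summand M {ffun 'I_n -> T}.
Proof.
move=> [s sE]; exists (size s).
pose d := (\0 : {linear M -> T}, \0 : {linear T -> M}).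
have [a aE] : exists a : {linear M -> {ffun 'I_(size s) -> T}},
    forall x, a x = [ffun i : 'I_(size s) => (nth d s i).1 x].
  by apply: ex_linear => c x y; apply/ffunP => i; rewrite !ffunE linearP.
have [b bE] : exists b : {linear {ffun 'I_(size s) -> T} -> M},
    forall y, b y = \sum_(i < size s) (nth d s i).2 (y i).
  apply: ex_linear => c x y; rewrite scaler_sumr -big_split /=.
  by apply: eq_bigr => i _; rewrite !ffunE linearP.
exists (ker b); apply: (@retract_summand _ _ a b) => x.
rewrite bE -[RHS]sE (big_nth d) big_mkord; apply: eq_bigr => i _.
by rewrite aE ffunE.
Qed.

(** Each component of the map lands in [T], hence extends to [N], and the extensions are added
    up. *)
Lemma finsummand_extends T X M N (i : {linear M -> N}) :
  finsummand T X -> extends T i -> extends X i.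
Proof.
move=> [s sE] iE f.
suff [f' f'E] : exists f' : {linear N -> X},
    forall x, f' (i x) = \sum_(u <- s) u.2 (u.1 (f x)).
  by exists f' => x; rewrite f'E sE.
elim: s {sE} => [|u s [f' f'E]]; first by exists \0 => x; rewrite big_nil.
have [h hE] := iE (u.1 \o f); exists ((u.2 \o h) \+ f') => x.
by rewrite big_cons /= hE f'E.
Qed.

Lemma prod_short_exact M N :
  exists2 i : {linear M -> (M * N)%type}, (forall x, i x = (x, 0)) &
    short_exact i (snd : {linear (M * N)%type -> N}).
Proof.
have [i iE] := ex_pair (idfun : {linear M -> M}) (\0 : {linear M -> N}).
exists i => //; split=> [x y|[y1 y2]|y]; first by rewrite !iE => -[].
- by split=> [/= ->|[x]]; [exists y1; rewrite iE|rewrite iE => -[_ <-]].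
- by exists (0, y).
Qed.

Lemma finsummand_eperp n T X M : eperp T n X -> finsummand X M -> eperp T n M.
Proof.
move=> TX; move: M; apply: finsummand_ind => // [M M0|M N ME NE|M Y a b ab YE].
- by apply: eperp_projective; exact: projective0.
- by have [i _ ie] := prod_short_exact M N; exact: eperp_extension ie ME NE.
- exact: eperp_stable_retract YE (retract_stable ab).
Qed.

Lemma finsummand_fgen T M : fgen T -> finsummand T M -> fgen M.
Proof.
move=> Tfg; move: M; apply: finsummand_ind => // [M M0|M N ME NE|M Y a b ab].
- by exists [::] => x; exact: M0.
- exact: fgen_prod.
- by apply: (@fgen_surj _ _ _ b) => x; exists (a x).
Qed.

Lemma finsummand_free n : finsummand A^o (free_module A n).
Proof.
elim: n => [|n IHn]; last exact: finsummand_prod (finsummand_refl _) IHn.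
by apply: finsummand_zero => x; apply/ffunP; case.
Qed.

Lemma fgen_projective_finsummand P : fgen P -> projective P -> finsummand A^o P.
Proof.
move=> /free_cover [n [g gS]] Pp.
have [a aE] := Pp _ _ g idfun gS.
exact: finsummand_retract aE (finsummand_free n).
Qed.

End Summands.

(** * Closure properties of Y by coinduction *)

Section Coresolving.
Variables (A : pzRingType) (T : lmodType A).
Hypothesis TT : forall n, eperp T n T.
Implicit Types M N L K P Q X V : lmodType A.

Definition perp M := forall n, eperp T n M.

(* The greatest class of modules M in perp T that embed in some X in add T with
   cokernel again in the class; it is Y T. *)
Definition coclosed (D : lmodType A -> Prop) := forall M, D M ->
  perp M /\ exists X M' (i : {linear M -> X}) (p : {linear X -> M'}),
    [/\ short_exact i p, finsummand T X & D M'].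

Definition Yco M := exists2 D, coclosed D & D M.

Lemma Yco_coclosed : coclosed Yco.
Proof.
move=> M [D Dco DM]; have [Mp [X [M' [i [p [ip XT DM']]]]]] := Dco M DM.
by split=> //; exists X, M', i, p; split=> //; exists D.
Qed.

(** Adjoining [M] to [Yco] leaves it coclosed. *)
Lemma Yco_intro M X M' (i : {linear M -> X}) (p : {linear X -> M'}) :
  perp M -> short_exact i p -> finsummand T X -> Yco M' -> Yco M.
Proof.
move=> Mp ip XT M'Y; exists (fun N => N = M \/ Yco N); last by left.
move=> N [->|/Yco_coclosed [Np [Y [N' [j [q [jq YT N'Y]]]]]]].
  by split=> //; exists X, M', i, p; split=> //; right.
by split=> //; exists Y, N', j, q; split=> //; right.
Qed.

Lemma Yco_iso M N : mod_iso M N -> Yco N -> Yco M.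
Proof.
move=> [e eb] /Yco_coclosed [Np [X [N' [i [p [ip XT N'Y]]]]]].
have [e' ee' e'e] := linear_inverse eb.
have Mp : perp M by move=> n; exact: eperp_stable_retract (Np n) (retract_stable ee').
apply: (@Yco_intro M X N' (i \o e) p) => //; have [iI ipE pS] := ip.
split=> // [x y /iI /(can_inj ee') //|y]; rewrite ipE.
by split=> [[x <-]|[x <-]]; [exists (e' x); rewrite /= e'e|exists (e x)].
Qed.

Lemma Yco_zero M : (forall x : M, x = 0) -> Yco M.
Proof.
move=> M0; exists (fun N : lmodType A => forall x : N, x = 0) => // N N0; split.
  by move=> n; apply: eperp_projective; exact: projective0.
exists N, N, idfun, idfun; split=> //; last exact: finsummand_zero.
by split=> // y; [split=> [_|_]; [exists y|exact: N0]|exists y].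
Qed.

Lemma Yco_self : Yco T.
Proof.
pose V : lmodType A := {ffun 'I_0 -> A^o}.
have V0 (x : V) : x = 0 by apply/ffunP; case.
apply: (@Yco_intro T T V idfun \0) => //; [|exact: finsummand_refl|exact: Yco_zero].
by split=> // y; [split=> // _; exists y|exists 0; rewrite [RHS]V0].
Qed.

Lemma Yco_extension M N L (i : {linear M -> N}) (p : {linear N -> L}) :
  short_exact i p -> Yco M -> Yco L -> Yco N.
Proof.
move=> ip MY LY.
(* The coclosed class is that of all extensions of members of [Yco]. *)
exists (fun N => exists M L (i : {linear M -> N}) (p : {linear N -> L}),
  [/\ short_exact i p, Yco M & Yco L]); last by exists M, L, i, p.
move=> {M N L i p ip MY LY} N [M [L [i [p [ip MY LY]]]]].
have [Mp [X [M' [i1 [p1 [ip1 XT M'Y]]]]]] := Yco_coclosed MY.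
have [Lp [Y [L' [i2 [p2 [ip2 YT L'Y]]]]]] := Yco_coclosed LY.
split; first by move=> n; exact: eperp_extension ip (Mp n) (Lp n).
(* Ext^1(L, T) = 0 extends [i1] to [N]; together with [i2 \o p] this embeds [N] in X + Y. *)
have [f fE] := finsummand_extends XT (eperp_extends (Lp 1) ip) i1.
have [j jE] := ex_pair f (i2 \o p).
have [iI ipE pS] := ip; have [i1I ip1E p1S] := ip1; have [i2I ip2E p2S] := ip2.
have jI : injective j.
  apply: linear_ker0 => x; rewrite jE => -[fx /= i2x].
  have [|m mE] := (ipE x).1; first by apply: i2I; rewrite i2x linear0.
  have m0 : m = 0 by apply: i1I; rewrite -fE mE fx linear0.
  by rewrite -mE m0 linear0.
have [q jq] := coker_short_exact jI; have [_ jqE qS] := jq.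
exists (X * Y)%type, (coker j), j, q; split=> //; first exact: finsummand_prod.
(* The cokernel of [j] becomes an extension of [L'] by [M'] through [u] and [v]. *)
have [c cE] := ex_pair (idfun : {linear X -> X}) (\0 : {linear X -> Y}).
have [|u uE] := factor_surj (f := q \o c) p1S.
  by move=> x /ip1E [m <-] /=; apply/jqE; exists (i m);
     rewrite jE cE fE /= (short_exact0 _ ip) linear0.
have [|v vE] := factor_surj (f := p2 \o snd) qS.
  by move=> x /jqE [n <-]; rewrite /= jE /= (short_exact0 _ ip2).
exists M', L', u, v; split=> //; split.
- apply: linear_ker0 => y; have [x <-] := p1S y; rewrite uE /= => /jqE [n].
  rewrite jE cE => -[fx /= i2n]; apply/ip1E.
  have [|m mE] := (ipE n).1; first by apply: i2I; rewrite i2n linear0.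
  by exists m; rewrite -fE mE.
- move=> y; have [[x z] <-] := qS y; split=> [|[m' <-]].
    rewrite vE /= => /ip2E [l <-].
    have [n <-] := pS l; exists (p1 (x - f n)); rewrite uE /= cE /=.
    apply/eqP; rewrite -subr_eq0 -linearB; apply/eqP/jqE; exists (- n).
    by rewrite linearN jE; congr (_, _); rewrite /= ?sub0r // addrAC subrr add0r.
  by have [w <-] := p1S m'; rewrite uE vE /= cE /= linear0.
- move=> l; have [z <-] := p2S l; exists (q (0, z)).
  by rewrite vE.
Qed.

Lemma Yco_ker M N (f : {linear M -> N}) : surj f -> Yco M -> Yco N -> Yco (ker f).
Proof.
move=> fS MY NY; have [k kf] := ker_short_exact fS; have [kI kfE _] := kf.
have [Mp [X [M' [i [p [ip XT M'Y]]]]]] := Yco_coclosed MY.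
have [Np _] := Yco_coclosed NY; have [iI ipE pS] := ip.
have ikI : injective (i \o k) by move=> x y /iI /kI.
have [q ikq] := coker_short_exact ikI; have [_ ikqE qS] := ikq.
apply: (Yco_intro (i := i \o k) (p := q)) => //.
  by move=> n; exact: eperp_ker kf (Mp n) (Np n.+1).
(* [u] embeds [N], which is M / ker f, in X / ker f. *)
have [|u uE] := factor_surj (f := q \o i) fS.
  by move=> x /kfE [y <-]; apply/ikqE; exists y.
have [|v vE] := factor_surj (f := p) qS.
  by move=> x /ikqE [y <-]; rewrite /= (short_exact0 _ ip).
apply: (Yco_extension (i := u) (p := v)) => //; split.
- apply: linear_ker0 => y; have [x <-] := fS y; rewrite uE /= => /ikqE [z] /= /iI <-.
  exact: short_exact0 kf.
- move=> y; have [x <-] := qS y; rewrite vE ipE.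
  split=> [[m <-]|[n uq]]; first by exists (f m); rewrite uE.
  apply/ipE; rewrite -vE -uq; have [m <-] := fS n; rewrite uE vE.
  exact: short_exact0 ip.
- by move=> y; have [x <-] := pS y; exists (q x); rewrite vE.
Qed.

(* If M + N embeds in X with cokernel L, then X/M + M is an extension of L by
   M + N, so X/M is again a summand of a member of the class. *)
Lemma Yco_summand M N : Yco (M * N)%type -> Yco M.
Proof.
move=> MNY; exists (fun M => exists N, Yco (M * N)%type); last by exists N.
move=> {MNY}M [{}N MNY].
have [MNp [X [M' [i [p [ip XT M'Y]]]]]] := Yco_coclosed MNY.
have [iI ipE pS] := ip.
have [c cE _] := prod_short_exact M N.
have ck : cancel c fst by move=> x; rewrite cE.
have Mp : perp M.
  by move=> n; exact: eperp_stable_retract (MNp n) (@retract_stable _ _ _ c fst ck).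
split=> //.
have icI : injective (i \o c) by move=> x y /iI /(can_inj ck).
have [q icq] := coker_short_exact icI; have [_ icqE qS] := icq.
exists X, (coker (i \o c)), (i \o c), q; split=> //.
(* The component [fst] recovers the summand [M] that [q \o i] kills, so [u] is injective. *)
exists M; have [u uE] := ex_pair (q \o i) (fst : {linear (M * N)%type -> M}).
have [|v vE] := factor_surj (f := p) qS.
  by move=> x /icqE [y <-]; rewrite /= (short_exact0 _ ip).
apply: (Yco_extension (i := u) (p := v \o fst)) MNY M'Y; split.
- apply: linear_ker0 => -[m n]; rewrite uE => -[/= /icqE [m'] /= /iI].
  by rewrite cE => -[_ <-] ->.
- move=> [y m]; have [x <-] := qS y; rewrite /= vE; split=> [/ipE [[m1 n1] <-]|].
    exists (m, n1); rewrite uE /=; congr (_, _); apply/eqP.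
    rewrite -subr_eq0 -linearB; apply/eqP/icqE; exists (m - m1).
    rewrite /= cE -linearB; congr (i (_, _)); by rewrite /= subrr.
  by move=> [z]; rewrite uE => -[/= zx _]; rewrite -vE -zx vE (short_exact0 _ ip).
- by move=> y; have [x <-] := pS y; exists (q x, 0); rewrite /= vE.
Qed.

Lemma Yco_retract M X (a : {linear M -> X}) (b : {linear X -> M}) :
  cancel a b -> Yco X -> Yco M.
Proof. by move=> /retract_summand /Yco_iso abX /abX /Yco_summand. Qed.

Lemma Yco_finsummand X M : Yco X -> finsummand X M -> Yco M.
Proof.
move=> XY; move: M; apply: finsummand_ind => // [|M N MY NY|M Y a b].
- exact: Yco_zero.
- by have [i _ ie] := prod_short_exact M N; exact: Yco_extension ie MY NY.
- exact: Yco_retract.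
Qed.
End Coresolving.

Lemma eperp_coef (A : pzRingType) (T X : lmodType A) n M :
  finsummand T X -> eperp T n M -> eperp X n M.
Proof.
move=> TX; elim: n M => [//|n IHn] M [K [Q [k [g [kg Qp kE KE]]]]].
by exists K, Q, k, g; split=> //; [exact: finsummand_extends TX kE|exact: IHn].
Qed.

(** [Yco T] is itself coclosed for [X]. This makes the correspondence well defined on classes. *)
Lemma Yco_coef (A : pzRingType) (T X M : lmodType A) :
  finsummand T X -> finsummand X T -> Yco T M -> Yco X M.
Proof.
move=> TX XT MY; exists (Yco T) => // N /Yco_coclosed [Np [U [N' [i [p [ip UT N'Y]]]]]].
split; first by move=> n; exact: eperp_coef TX (Np n).
by exists U, N', i, p; split=> //; exact: finsummand_trans UT.
Qed.

(** * Wakamatsu tilting modules and resolving subcategories *)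

Section Wakamatsu.
Variable R : pzRingType.
Hypothesis nR : right_noetherian R.
Implicit Types (T M N X : rmodType R) (C : mod_class R).

Let nA : noetherian R^c := right_noetherianP nR.

Lemma addP T M : add T M <-> finsummand T M.
Proof. by split=> [[n /summand_finsummand]|/finsummand_summand]. Qed.

Lemma fgen_regular : fgen (R^c^o : rmodType R).
Proof.
exists [:: 1] => x; exists x, 0; rewrite addr0; split=> //.
by rewrite /GRing.scale /= mulr1.
Qed.

Lemma Ext_projective n (P M : rmodType R) : projective P -> Ext_zero n.+1 P M.
Proof. by move=> Pp; apply: eperp_Ext; exact: eperp_projective. Qed.

Lemma cogen_star_fgen T M : fgen T -> cogen_star T M -> fgen M.
Proof.
move=> Tfg [P [/(_ 0) /addP /(finsummand_fgen Tfg) P0fg _ _]].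
exact: fgen_inj nA (@cores_aug_inj _ _ P) P0fg.
Qed.

Section YP.
Variable T : rmodType R.
Hypotheses (Tfg : fgen T) (TT : perp T T).

(** [cogen_star] controls only Ext^1 of the cokernels; the higher Ext^(n+1)(M', T) vanish because
    Ext^n(M, T) and Ext^(n+1)(X, T) do. *)
Lemma perp_coker M X M' (i : {linear M -> X}) (p : {linear X -> M'}) :
  short_exact i p -> finsummand T X -> Ext_zero 1 M' T -> perp T M -> perp T M'.
Proof.
move=> ip XT M'E Mp [//|n].
have Xp : perp T X by move=> m; exact: finsummand_eperp (TT m) XT.
have M'1 : eperp T 1 M'.
  apply: Ext_eperp nA _ _; last by case=> [|[|i0]].
  by case: ip => _ _ pS; exact: fgen_surj pS (finsummand_fgen Tfg XT).
exact: eperp_coker ip (eperp_extends M'1 ip) (Mp n) (Xp n.+1).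
Qed.

(** Splicing the sequences given by coclosedness yields a coresolution. Conversely [M] and the
    cokernels along a coresolution form a coclosed class, by [perp_coker]. *)
Lemma YP M : Y T M <-> Yco T M.
Proof.
split=> [[Mp Mc]|MY]; last first.
  split; first by move=> [//|i] _; apply: eperp_Ext; case: (Yco_coclosed MY).
  have [||P [PT P0 Pd]] := coresolution_of_step (E := add T) (F := eperp T 1) _ _ MY.
  - move=> N /Yco_coclosed [Np [X [N' [i [p [ip XT N'Y]]]]]].
    exists (Copresentation ip); split=> //; first exact/addP.
    by case: (Yco_coclosed N'Y).
  - by move=> N L NL /eperp_stable_retract; apply.
  by exists P; split=> [//||i]; exact: eperp_Ext.
have Mfg := cogen_star_fgen Tfg Mc; have {}Mp := (left_perp_eperp T nA Mfg).1 Mp.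
have [P [PT P0 Pd]] := Mc.
exists (fun X => perp T X /\
  [\/ X = M, X = coker (cores_aug P) | exists i, X = coker (cores_d P i)]); last first.
  by split=> //; exact: Or31.
move=> X [Xp XE]; split=> //; case: XE Xp => [->|->|[i ->]] Xp.
- have [p ip] := coker_short_exact (@cores_aug_inj _ _ P).
  have P0T : finsummand T (P 0) by exact/addP.
  exists (P 0), (coker (cores_aug P)), (cores_aug P), p; split=> //; split.
    exact: perp_coker ip P0T P0 Xp.
  exact: Or32.
- have [u [q uq]] := coker_induced (@cores_aug_exact _ _ P).
  have P1T : finsummand T (P 1) by exact/addP.
  exists (P 1), (coker (cores_d P 0)), u, q; split=> //; split.
    exact: perp_coker uq P1T (Pd 0) Xp.
  by apply: Or33; exists 0.
- have [u [q uq]] := coker_induced (@cores_d_exact _ _ P i).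
  have PiT : finsummand T (P i.+2) by exact/addP.
  exists (P i.+2), (coker (cores_d P i.+1)), u, q; split=> //; split.
    exact: perp_coker uq PiT (Pd i.+1) Xp.
  by apply: Or33; exists i.+1.
Qed.
End YP.

Lemma wakamatsu_fgen T : wakamatsu_tilting T -> fgen T.
Proof.
move=> [_ [P [/(_ 0) /addP /(finsummand_fgen fgen_regular) P0fg _ _]] _].
exact: fgen_surj (@res_aug_surj _ _ P) P0fg.
Qed.

Lemma wakamatsu_perp T : wakamatsu_tilting T -> perp T T.
Proof. by move=> Tw; case: (Tw) => /(left_perp_eperp T nA (wakamatsu_fgen Tw)). Qed.

Lemma wakamatsuP T M : wakamatsu_tilting T -> Y T M <-> Yco T M.
Proof. by move=> Tw; apply: YP; [exact: wakamatsu_fgen|exact: wakamatsu_perp]. Qed.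

Lemma Y_resolving T : wakamatsu_tilting T -> resolving (Y T).
Proof.
move=> Tw; have Tfg := wakamatsu_fgen Tw; have YE M := wakamatsuP M Tw.
have isoY M N : mod_iso M N -> Y T M -> Y T N.
  move=> [e eb] /YE MY; have [e' ee' e'e] := linear_inverse eb.
  by apply/YE; exact: Yco_retract e'e MY.
split.
- split=> // M [_ Mc]; apply/fin_genP; exact: cogen_star_fgen Tfg Mc.
- by move=> M X [N MN] /YE XY; apply/YE; exact: Yco_summand (Yco_iso MN XY).
- by move=> M N L f g fg /YE MY /YE LY; apply/YE; exact: Yco_extension fg MY LY.
- by move=> M N f fS /YE MY /YE NY; apply/YE; exact: Yco_ker.
- move=> P /fin_genP Pfg Pp; apply/YE.
  (* It suffices to treat [R], which is projective and lies in [cogen_star T]. *)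
  apply: Yco_finsummand (fgen_projective_finsummand Pfg Pp).
  apply/YE; split; last by case: Tw.
  by move=> [//|i] _; apply: Ext_projective; exact: projective_regular.
Qed.

Lemma Y_cogenerator T : wakamatsu_tilting T -> ext_injective_cogenerator (Y T) T.
Proof.
move=> Tw; have YE M := wakamatsuP M Tw.
split; first by apply/YE; apply: Yco_self; exact: wakamatsu_perp.
  by move=> X i [Xp _]; exact: Xp.
move=> M /YE /Yco_coclosed [_ [X [M' [i [p [ip XT M'Y]]]]]].
by exists X, M', i, p; split=> //; [exact/addP|exact/YE].
Qed.

(** [C] itself is coclosed: Ext-injectivity of [T] gives the perpendicularity, the cogenerator
    property the embeddings. *)
Lemma cogenerator_Yco C T M : resolving C -> ext_injective_cogenerator C T -> C M -> Yco T M.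
Proof.
move=> [[Cfg _] _ _ _ _] [_ CT Ccog] CM; exists C => // N CN; split.
  by apply/(left_perp_eperp T nA ((fin_genP N).1 (Cfg N CN))) => i; exact: CT.
have [X [N' [f [g [fg /addP XT CN']]]]] := Ccog N CN.
by exists X, N', f, g.
Qed.

(** A free resolution of [T] gives [gen_star], the Ext conditions holding because [R] is projective.
    [cogen_star] holds since [R] lies in [C], hence in [Yco T]. *)
Lemma cogenerator_wakamatsu C T :
  resolving C -> ext_injective_cogenerator C T -> wakamatsu_tilting T.
Proof.
move=> Cr Tcog; have [[Cfg _] _ _ _ Cproj] := Cr; have [CT TC _] := Tcog.
have Tfg := (fin_genP T).1 (Cfg T CT).
have TT i : (1 <= i)%N -> Ext_zero i T T by exact: TC.
split=> //.
  have [P PE] := fgen_free_resolution nA Tfg; exists P; split=> [i||i].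
  - by have [n ->] := PE i; apply/addP; exact: finsummand_free.
  - by apply: Ext_projective; exact: projective_regular.
  - by apply: Ext_projective; exact: projective_regular.
have TTp := (left_perp_eperp T nA Tfg).1 TT.
have CR : C R^c^o.
  by apply: Cproj; [apply/fin_genP; exact: fgen_regular|exact: projective_regular].
by have /(YP Tfg TTp) [] := cogenerator_Yco Cr Tcog CR.
Qed.

Lemma Y_eq_finsummand T T' : wakamatsu_tilting T -> wakamatsu_tilting T' ->
  Y T = Y T' -> finsummand T' T.
Proof.
move=> Tw T'w YTT'.
have /(wakamatsuP _ T'w) : Y T' T by rewrite -YTT'; case: (Y_cogenerator Tw).
move=> /Yco_coclosed [_ [X [M' [i [p [ip XT' /(wakamatsuP _ T'w)]]]]]].
rewrite -YTT' => /(wakamatsuP _ Tw) /Yco_coclosed [M'p _].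
have [r rE] := eperp_extends (M'p 1) ip idfun.
exact: (@finsummand_retract _ _ _ _ i r) XT'.
Qed.

End Wakamatsu.

(** * Equivalence of modules *)

Section TensorLift.
Variables (B : pzRingType) (P : rmodType B) (M : lmodType B).

Lemma pure_bal (b : B) (p : P) (m : M) : pure ((b : B^c) *: p) m = pure p (b *: m).
Proof. by apply/tens_piP; exact: tens_bal. Qed.

Lemma pure0l (m : M) : pure (0 : P) m = 0.
Proof. by apply: (addIr (pure 0 m)); rewrite -pureDl !add0r. Qed.

Lemma pure_suml I (s : seq I) (F : I -> P) (m : M) :
  pure (\sum_(i <- s) F i) m = \sum_(i <- s) pure (F i) m.
Proof.
by elim: s => [|i s IHs]; rewrite ?big_nil ?pure0l // !big_cons pureDl IHs.
Qed.

Lemma tensor_sum (x : tensor P M) :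
  exists s : seq (P * M), x = \sum_(u <- s) pure u.1 u.2.
Proof.
elim/tensor_ind: x => [|p m x [s ->]]; first by exists [::]; rewrite big_nil.
by exists ((p, m) :: s); rewrite big_cons.
Qed.

Lemma tensor_lift (Z : zmodType) (f : P -> M -> Z) :
  (forall p q m, f (p + q) m = f p m + f q m) ->
  (forall p m n, f p (m + n) = f p m + f p n) ->
  (forall p (b : B) m, f ((b : B^c) *: p) m = f p (b *: m)) ->
  exists h : tensor P M -> Z,
    (forall x y, h (x + y) = h x + h y) /\ forall p m, h (pure p m) = f p m.
Proof.
move=> fDl fDr fb; pose S s := \sum_(u <- s) f u.1 u.2.
have SE s t : tens_eq s t -> S s = S t.
  rewrite /S; elim=> {s t} [//|s t _ -> //|s t u _ -> _ //|s s' t t' _ E _ E'|s t|m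
                            |p q m|p m n|p b m].
  - by rewrite !big_cat /= E E'.
  - by rewrite !big_cat /= addrC.
  - by rewrite big_seq1 big_nil; apply: (addIr (f 0 m)); rewrite -fDl !add0r.
  - by rewrite big_seq1 !big_cons big_nil addr0 fDl.
  - by rewrite big_seq1 !big_cons big_nil addr0 fDr.
  - by rewrite !big_seq1 fb.
exists (fun x => S (tens_repr x)); split=> [x y|p m].
  rewrite -[RHS](_ : S (tens_repr x ++ tens_repr y) = _); last by rewrite /S big_cat.
  exact: SE (tens_eq_repr _).
by rewrite (SE _ _ (tens_eq_repr _)) /S big_seq1.
Qed.
End TensorLift.

Lemma tensor_additive_eq (B : pzRingType) (P : rmodType B) (M : lmodType B) (Z : zmodType)
    (f g : tensor P M -> Z) :
  (forall x y, f (x + y) = f x + f y) -> (forall x y, g (x + y) = g x + g y) ->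
  (forall p m, f (pure p m) = g (pure p m)) -> f =1 g.
Proof.
move=> fD gD fg; elim/tensor_ind=> [|p m x IHx]; last by rewrite fD gD fg IHx.
have f0 : f 0 = 0 by apply: (addIr (f 0)); rewrite -fD !add0r.
by have g0 : g 0 = 0 by [apply: (addIr (g 0)); rewrite -gD !add0r]; rewrite f0 g0.
Qed.

Lemma ltensor_scale_pure (A B : pzRingType) (P : bimod A B) (M : lmodType B)
    a (p : P) (m : M) :
  a *: (pure p m : ltensor P M) = pure (lact P a p) m.
Proof. exact: tens_map_pure. Qed.

(** * Finite dual bases of invertible bimodules *)

Section DualBasis.
Variables (A B : pzRingType) (P : bimod A B).

Lemma fmap_pure (M N : lmodType B) (f : {linear M -> N}) (p : P) (m : M) :
  fmap (tensor_functor P) f (pure p m) = pure p (f m).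
Proof. exact: tens_map_pure. Qed.

(* The tensor functor is additive and faithful, hence so is a quasi-inverse. *)
Lemma equivalence_additive (G : mod_functor A B) :
  nat_iso (comp_functor G (tensor_functor P)) (id_functor B) ->
  nat_iso (comp_functor (tensor_functor P) G) (id_functor A) ->
  forall (M N : lmodType A) (f g h : {linear M -> N}),
  (forall x, h x = f x + g x) -> forall x, fmap G h x = fmap G f x + fmap G g x.
Proof.
move=> [th [thb thE0]] [ph [phb phE0]]; pose F := tensor_functor P.
have thE (M N : lmodType B) (f : {linear M -> N}) x :
  th N (fmap G (fmap F f) x) = f (th M x) := thE0 M N f x.
have phE (M N : lmodType A) (f : {linear M -> N}) x :
  ph N (fmap F (fmap G f) x) = f (ph M x) := phE0 M N f x.
move=> M N f g h hE.
pose k : {linear G M -> G N} := fmap G f \+ fmap G g.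
(* Naturality of [th] makes [F] faithful, so the equality may be tested after applying [F]. *)
suff /linear_ext E : fmap F (fmap G h) =1 fmap F k.
  by move=> x; have [t _ tK] := thb (G M); rewrite -(tK x) -thE E thE.
move=> x; apply: (bij_inj (phb N)).
rewrite [LHS]phE hE -!phE -linearD; congr (ph N _).
move: x; apply: tensor_additive_eq => [x y|x y|p m].
- by rewrite !linearD addrACA.
- by rewrite linearD.
- by rewrite !fmap_pure -pureDr.
Qed.

(* With Q = G(A) and 1 = sum p_i (x) q_i under P (x) Q = A, the dual basis has
   the functionals p |-> G(a |-> a p)(q_i), up to the identification GF(B) = B. *)
Lemma invertible_dual_basis : invertible P ->
  exists s : seq (P * {linear P -> B^c^o}),
    forall p, \sum_(u <- s) (u.2 p : B^c) *: u.1 = p.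
Proof.
move=> [G [GF FG]]; have GD := equivalence_additive GF FG.
have [th [thb thE0]] := GF; have [ph [phb phE0]] := FG.
pose F := tensor_functor P.
have thE (M N : lmodType B) (f : {linear M -> N}) x :
  th N (fmap G (fmap F f) x) = f (th M x) := thE0 M N f x.
have phE (M N : lmodType A) (f : {linear M -> N}) x :
  ph N (fmap F (fmap G f) x) = f (ph M x) := phE0 M N f x.
have [ph' _ ph'K] := phb A^o; have [s sE] := tensor_sum (ph' 1).
have [th' thK th'K] := thb B^o.
have rE0 (b : B) : exists r : {linear B^o -> B^o}, forall x : B, r x = x * b.
  by apply: ex_linear => a x y; rewrite mulrDl -mulrA.
have [r rE] := choice rE0.
(* [rho p] will be the map A -> P (x) B sending a to a (p (x) 1). *)
pose FS : lmodType A := F B^o.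
pose e (p : P) : FS := @pure B P B^o p 1.
have [rho rhoE] := choice (fun p => regular_map (e p)).
have rho1 p : rho p 1 = e p by rewrite rhoE scale1r.
pose f (q : G A^o) (p : P) : B^c^o := th B^o (fmap G (rho p) q).
have fD q p p' : f q (p + p') = f q p + f q p'.
  rewrite /f (GD _ _ (rho p) (rho p')) ?linearD // => a.
  by rewrite !rhoE -scalerDr /e pureDl.
have fZ q p (b : B) : f q ((b : B^c) *: p) = r b (f q p).
  rewrite /f -thE -[fmap G (fmap F _) _]fmap_comp.
  congr (th _ (fmap G _ q)); apply: linear_ext => a /=.
  rewrite !rhoE /e pure_bal linearZ; congr (_ *: _).
  by rewrite [RHS]fmap_pure rE mul1r /GRing.scale /= mulr1.
have fl q : exists g : {linear P -> B^c^o}, forall p, g p = f q p.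
  by apply: ex_linear => b p p'; rewrite fD; congr (_ + _); exact: etrans (fZ _ _ _) (rE _ _).
have [g gE] := choice fl.
have [ep [epD epE]] : exists ep : tensor P B^o -> P,
    (forall x y, ep (x + y) = ep x + ep y) /\
    forall (p : P) (b : B), ep (@pure B P B^o p b) = (b : B^c) *: p.
  apply: (@tensor_lift B P B^o P (fun (p : P) (b : B) => (b : B^c) *: p)).
  - by move=> p p' b; rewrite scalerDr.
  - by move=> p b b'; rewrite -scalerDl.
  - by move=> p b b'; rewrite scalerA.
have epr (b : B) x : ep (fmap F (r b) x) = (b : B^c) *: ep x.
  move: x; apply: tensor_additive_eq => [x y|x y|p c].
  - by rewrite linearD epD.
  - by rewrite epD scalerDr.
  - by rewrite fmap_pure !epE rE scalerA.
have ep0 : ep 0 = 0 by apply: (addIr (ep 0)); rewrite -epD !add0r.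
(* [w p] is the image of p (x) th^-1(1) under P (x) GF(B) -> F(B). Through [ep], the p_i yield the
   vectors of the dual basis. *)
pose w (p : P) : FS := ph FS (@pure B P (G FS) p (th' (1 : B))).
exists [seq (ep (w u.1), g u.2) | u <- s] => p; rewrite big_map.
(* One element computed twice: naturality of [ph] returns p, while expanding [ph' 1] as the sum of
   the p_i (x) q_i gives the dual basis expansion. *)
transitivity (ep (ph FS (fmap F (fmap G (rho p)) (ph' 1)))); last first.
  by rewrite phE ph'K rho1 epE scale1r.
rewrite sE 2!linear_sum (big_morph ep epD ep0); apply: eq_bigr => u _ /=.
rewrite -epr /w -phE !fmap_pure; congr (ep (ph FS (pure _ _))).
apply: (bij_inj (thb B^o)); rewrite thE th'K rE mul1r; exact: gE.
Qed.
End DualBasis.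

(** * From equivalence to additive equivalence *)

Section SimSummand.
Variable R : pzRingType.
Implicit Types T U : rmodType R.

(** Tensored with [U], a dual basis of [P] over End(U) writes the identity of P (x) U as a finite
    sum of maps through [U]. *)
Lemma invertible_tensor_summand T U (P : bimod (endo T) (endo U)) :
  invertible P -> finsummand U (rtensor P (endo_bimod U)).
Proof.
move=> /invertible_dual_basis [s sE]; pose X : rmodType R := rtensor P (endo_bimod U).
pose pu (p : P) (x : U) : X := @pure (endo U) P (left_mod (endo_bimod U)) p x.
have scale_pu (c : R^c) p x : c *: pu p x = pu p (c *: x) by exact: tens_map_pure.
have aE0 (u : P * {linear P -> (endo U)^c^o}) : exists a : {linear X -> U},
    forall p x, a (pu p x) = (u.2 p : endo U) x.
  have [|||h [hD hE]] := @tensor_lift (endo U) P (left_mod (endo_bimod U)) U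
    (fun p x => (u.2 p : endo U) x).
  - by move=> p q x; rewrite linearD.
  - by move=> p x y; rewrite linearD.
  - by move=> p b x; rewrite linearZ.
  have [|a aE] := @ex_linear _ X U h; last by exists a => p x; rewrite aE hE.
  move=> c x y; rewrite hD; congr (_ + _); move: x.
  apply: tensor_additive_eq => [x z|x z|p x].
  - by rewrite scalerDr hD.
  - by rewrite hD scalerDr.
  - by rewrite [c *: _]scale_pu !hE linearZ.
have bE0 (u : P * {linear P -> (endo U)^c^o}) : exists b : {linear U -> X},
    forall x, b x = pu u.1 x.
  by apply: ex_linear => c x y; rewrite scale_pu; exact: pureDr.
have [a aE] := choice aE0; have [b bE] := choice bE0.
exists [seq (a u, b u) | u <- s] => x; rewrite big_map; move: x.
apply: tensor_additive_eq => [x y|//|p x].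
  by rewrite -big_split; apply: eq_bigr => u _; rewrite !linearD.
rewrite -[RHS](congr1 (fun q => pure q x) (sE p)) pure_suml; apply: eq_bigr => u _ /=.
by rewrite bE aE pure_bal.
Qed.

Lemma sim_summand T U : sim T U -> finsummand U T /\ finsummand T U.
Proof.
move=> [P [Q [Pi Qi [e /linear_inverse [e' ee' _]] [f /linear_inverse [f' ff' _]]]]].
split; first exact: finsummand_retract ee' (invertible_tensor_summand Pi).
exact: finsummand_retract ff' (invertible_tensor_summand Qi).
Qed.
End SimSummand.

(** * The bimodule Hom(U, T) *)

Section HomBimodule.
Variables (R : pzRingType) (U T : rmodType R).

Definition hom := {linear U -> T}.

HB.instance Definition _ := gen_eqMixin hom.
HB.instance Definition _ := gen_choiceMixin hom.

Definition hom_zero : hom := \0 : {linear U -> T}.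
Definition hom_opp (f : hom) : hom := \- (f : {linear U -> T}) : {linear U -> T}.
Definition hom_add (f g : hom) : hom :=
  (f : {linear U -> T}) \+ (g : {linear U -> T}) : {linear U -> T}.

Fact hom_addA : associative hom_add.
Proof. by move=> f g h; apply: linear_ext => x /=; rewrite addrA. Qed.
Fact hom_addC : commutative hom_add.
Proof. by move=> f g; apply: linear_ext => x /=; rewrite addrC. Qed.
Fact hom_add0 : left_id hom_zero hom_add.
Proof. by move=> f; apply: linear_ext => x /=; rewrite add0r. Qed.
Fact hom_addN : left_inverse hom_zero hom_opp hom_add.
Proof. by move=> f; apply: linear_ext => x /=; rewrite addNr. Qed.

HB.instance Definition _ :=
  GRing.isZmodule.Build hom hom_addA hom_addC hom_add0 hom_addN.

Definition hom_scale (s : (endo U)^c) (f : hom) : hom :=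
  (f : {linear U -> T}) \o (s : {linear U -> U}) : {linear U -> T}.

Fact hom_scaleA s t f : hom_scale s (hom_scale t f) = hom_scale (s * t) f.
Proof. by apply: linear_ext. Qed.
Fact hom_scale1 : left_id 1 hom_scale.
Proof. by move=> f; apply: linear_ext. Qed.
Fact hom_scaleDr : right_distributive hom_scale +%R.
Proof. by move=> s f g; apply: linear_ext. Qed.
Fact hom_scaleDl f : {morph hom_scale^~ f : s t / s + t}.
Proof. by move=> s t; apply: linear_ext => x /=; rewrite linearD. Qed.

HB.instance Definition _ := GRing.Zmodule_isLmodule.Build (endo U)^c hom
  hom_scaleA hom_scale1 hom_scaleDr hom_scaleDl.

Definition hom_lact (a : endo T) (f : hom) : hom :=
  (a : {linear T -> T}) \o (f : {linear U -> T}) : {linear U -> T}.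

Fact hom_lact_linear a : linear (hom_lact a).
Proof. by move=> s f g; apply: linear_ext => x /=; rewrite linearD. Qed.

HB.instance Definition _ a :=
  GRing.isLinear.Build (endo U)^c hom hom _ (hom_lact a) (hom_lact_linear a).

Fact hom_lact1 : hom_lact 1 =1 id.
Proof. by move=> f; apply: linear_ext. Qed.
Fact hom_lactM a b : hom_lact (a * b) =1 hom_lact a \o hom_lact b.
Proof. by move=> f; apply: linear_ext. Qed.
Fact hom_lactD a b : hom_lact (a + b) =1 hom_lact a \+ hom_lact b.
Proof. by move=> f; apply: linear_ext. Qed.

Definition hom_bimod : bimod (endo T) (endo U) :=
  @Bimod (endo T) (endo U) hom (fun a => hom_lact a : {linear hom -> hom})
    hom_lact1 hom_lactM hom_lactD.
End HomBimodule.

(** * From additive equivalence to equivalence *)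

Section SummandSim.
Variable R : pzRingType.
Implicit Types T U : rmodType R.

Lemma hom_sumE T U I (s : seq I) (F : I -> hom T U) x :
  (\sum_(i <- s) F i : hom T U) x = \sum_(i <- s) F i x.
Proof. exact: (big_morph (fun f : hom T U => f x) (fun _ _ => erefl) erefl). Qed.

Lemma endo_sumE T I (s : seq I) (F : I -> endo T) x :
  (\sum_(i <- s) F i : endo T) x = \sum_(i <- s) F i x.
Proof. exact: (big_morph (fun f : endo T => f x) (fun _ _ => erefl) erefl). Qed.

Definition hom_comp T U V (q : hom U V) (p : hom T U) : hom T V :=
  (q : {linear U -> V}) \o (p : {linear T -> U}) : {linear T -> V}.

(** Half of a Morita equivalence: q (x) p (x) m goes to (q p) m. Writing the identity of [U] as the
    sum of the u.2 u.1 gives the inverse, m to the sum of the u.2 (x) u.1 (x) m. *)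
Lemma hom_comp_nat_iso T U : finsummand T U ->
  nat_iso (comp_functor (tensor_functor (hom_bimod T U)) (tensor_functor (hom_bimod U T)))
    (id_functor (endo U)).
Proof.
move=> [s sE]; pose P := hom_bimod U T; pose Q := hom_bimod T U.
pose pp (M : lmodType (endo U)) (q : Q) (p : P) (m : M) : ltensor Q (ltensor P M) :=
  pure q (pure p m : ltensor P M).
have ex_eta (M : lmodType (endo U)) : exists e : {linear ltensor Q (ltensor P M) -> M},
    forall q p m, e (pp M q p m) = (hom_comp q p : endo U) *: m.
  have hE0 (q : Q) : exists h : ltensor P M -> M,
      (forall x y, h (x + y) = h x + h y) /\
      forall p m, h (pure p m) = (hom_comp q p : endo U) *: m.
    apply: tensor_lift => [p p' m|p m n|p b m].
    - by rewrite -scalerDl; congr (_ *: _); apply: linear_ext => x /=; rewrite linearD.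
    - by rewrite scalerDr.
    - by rewrite scalerA; congr (_ *: _); apply: linear_ext.
  have [h hE] := choice hE0.
  have hD q x y : h q (x + y) = h q x + h q y by case: (hE q).
  have {}hE q p m : h q (pure p m) = (hom_comp q p : endo U) *: m by case: (hE q).
  have [|||e [eD eE]] := @tensor_lift _ Q (ltensor P M) M h => //.
  - move=> q q'; apply: tensor_additive_eq => [x y|x y|p m].
    + exact: hD.
    + by rewrite !hD addrACA.
    + by rewrite !hE -scalerDl; congr (_ *: _); exact: linear_ext.
  - move=> q a; apply: tensor_additive_eq => [x y|x y|p m].
    + exact: hD.
    + by rewrite scalerDr hD.
    + by rewrite ltensor_scale_pure !hE; congr (_ *: _); exact: linear_ext.
  have [|e' e'E] := @ex_linear _ (ltensor Q (ltensor P M)) M e; last first.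
    by exists e' => q p m; rewrite e'E eE hE.
  move=> b x y; rewrite eD; congr (_ + _); move: x.
  apply: tensor_additive_eq => [x z|x z|q x].
  - by rewrite scalerDr eD.
  - by rewrite eD scalerDr.
  - rewrite ltensor_scale_pure !eE; move: x.
    apply: tensor_additive_eq => [x z|x z|p m].
    + exact: hD.
    + by rewrite hD scalerDr.
    + by rewrite !hE scalerA; congr (_ *: _); exact: linear_ext.
pose eta M := sval (cid (ex_eta M)).
have etaE M : forall q p m, eta M (pp M q p m) = (hom_comp q p : endo U) *: m :=
  svalP (cid (ex_eta M)).
have pp_eq (M : lmodType (endo U)) (Z : zmodType) (f g : ltensor Q (ltensor P M) -> Z) :
  (forall x y, f (x + y) = f x + f y) -> (forall x y, g (x + y) = g x + g y) ->
  (forall q p m, f (pp M q p m) = g (pp M q p m)) -> f =1 g.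
  move=> fD gD fg; apply: tensor_additive_eq => // q.
  apply: tensor_additive_eq => [x y|x y|p m]; last exact: fg.
    by rewrite pureDr fD.
  by rewrite pureDr gD.
pose inv M m := \sum_(u <- s) pp M (u.2 : Q) (u.1 : P) m.
have invK M : cancel (inv M) (eta M).
  move=> m; rewrite linear_sum; under eq_bigr do rewrite etaE.
  rewrite -scaler_suml -[RHS]scale1r; congr (_ *: _); apply: linear_ext => x.
  by rewrite endo_sumE /= sE.
have invD M m n : inv M (m + n) = inv M m + inv M n.
  by rewrite -big_split; apply: eq_bigr => u _; rewrite /pp !pureDr.
have etaK M : cancel (eta M) (inv M).
  apply: pp_eq => [x y|//|q p m]; first by rewrite linearD invD.
  rewrite etaE /inv.
  (* With the identity of [U] inserted at [q], the scalars u.1 q in End(T) and q p in End(U) move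
     across the two tensor signs. *)
  have -> : pp M q p m = pp M (\sum_(u <- s) hom_comp (hom_comp u.2 u.1 : hom U U) q) p m.
    by congr (pp M _ p m); apply: linear_ext => x; rewrite hom_sumE /= sE.
  rewrite /pp pure_suml; apply: eq_bigr => u _.
  rewrite -(pure_bal (hom_comp q p : endo U)).
  rewrite (_ : _ *: (u.1 : P) = lact P (hom_comp u.1 q : endo T) p); last exact: linear_ext.
  rewrite -ltensor_scale_pure -pure_bal; congr (pure _ _); exact: linear_ext.
exists eta; split=> [M|M N f]; first exact: Bijective (etaK M) (invK M).
apply: pp_eq => [x y|x y|q p m]; rewrite /= ?linearD //.
rewrite etaE linearZ /= -etaE; congr (eta N _).
by rewrite [LHS]fmap_pure fmap_pure.
Qed.

(** Evaluation Hom(U, T) (x) U -> T is inverted by t to the sum of the u.2 (x) u.1 t. Linearity is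
    established for this inverse. *)
Lemma hom_eval_iso T U : finsummand U T ->
  mod_iso T (rtensor (hom_bimod U T) (endo_bimod U)).
Proof.
move=> [s sE]; pose P := hom_bimod U T; pose X : rmodType R := rtensor P (endo_bimod U).
pose pu (p : P) (x : U) : X := @pure (endo U) P (left_mod (endo_bimod U)) p x.
have scale_pu (c : R^c) p x : c *: pu p x = pu p (c *: x) by exact: tens_map_pure.
have [e eE] : exists e : {linear T -> X}, forall t, e t = \sum_(u <- s) pu (u.2 : P) (u.1 t).
  apply: ex_linear => c x y; rewrite scaler_sumr -big_split /=; apply: eq_bigr => u _.
  by rewrite linearP scale_pu; exact: pureDr.
have [|||h [hD hE]] := @tensor_lift (endo U) P (left_mod (endo_bimod U)) T
  (fun (p : P) x => (p : hom U T) x) => //.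
  by move=> p x y; rewrite linearD.
have h0 : h 0 = 0 by apply: (addIr (h 0)); rewrite -hD !add0r.
exists e; exists h => [t|x].
  by rewrite eE (big_morph h hD h0) -[RHS]sE; apply: eq_bigr => u _; rewrite hE.
move: x; apply: tensor_additive_eq => [x y|//|p x]; first by rewrite hD linearD.
rewrite hE eE.
have -> : pure p x = pure (\sum_(u <- s) hom_comp u.2 (hom_comp u.1 p) : P)
    (x : left_mod (endo_bimod U)).
  by congr pure; apply: linear_ext => y; rewrite hom_sumE /= sE.
rewrite pure_suml; apply: eq_bigr => u _.
rewrite (_ : hom_comp u.2 _ = ((hom_comp u.1 p : endo U) : (endo U)^c) *: (u.2 : P)).
  by rewrite pure_bal.
exact: linear_ext.
Qed.

Lemma simP T U : sim T U <-> finsummand U T /\ finsummand T U.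
Proof.
split; first exact: sim_summand.
move=> [UT TU]; exists (hom_bimod U T), (hom_bimod T U); split.
- by exists (tensor_functor (hom_bimod T U)); split; exact: hom_comp_nat_iso.
- by exists (tensor_functor (hom_bimod U T)); split; exact: hom_comp_nat_iso.
- exact: hom_eval_iso.
- exact: hom_eval_iso.
Qed.
End SummandSim.

(** * The correspondence *)

Theorem theorem1p4 (R : pzRingType) : right_noetherian R ->
  exists Phi : mod_class R -> mod_class R,
    [/\ forall T : rmodType R, wakamatsu_tilting T -> Phi (sim_class T) = Y T,
        forall K, tilting_class K -> maximal_resolving (Phi K),
        forall K K', tilting_class K -> tilting_class K' ->
          Phi K = Phi K' -> K = K' &
        forall C, maximal_resolving C ->
          exists2 K, tilting_class K & Phi K = C].
Proof.
(* No representative is chosen: [Phi K] collects [Y T] over all tilting [T] with class [K], and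
   [PhiE] shows that these agree. *)
move=> nR; pose Phi (K : mod_class R) : mod_class R :=
  fun M => exists T, [/\ wakamatsu_tilting T, K = sim_class T & Y T M].
have PhiE T : wakamatsu_tilting T -> Phi (sim_class T) = Y T.
  move=> Tw; apply/funext => M; apply/propext; split=> [[U [Uw TU MY]]|MY]; last by exists T.
  have /simP [UT TU'] : sim T U.
    have UU : sim_class U U by apply/simP; split; exact: finsummand_refl.
    by rewrite -TU in UU.
  by apply/(wakamatsuP nR _ Tw); apply: Yco_coef UT TU' _; apply/(wakamatsuP nR _ Uw).
(* This gives the maximality of [Y T] and, below, surjectivity. *)
have sub (C : mod_class R) T M : resolving C -> ext_injective_cogenerator C T -> C M -> Y T M.
  move=> Cr CT CM; have Tw := cogenerator_wakamatsu nR Cr CT.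
  by apply/(wakamatsuP nR M Tw); exact: cogenerator_Yco Cr CT CM.
exists Phi; split=> // [_ [T Tw ->]|_ _ [T Tw ->] [U Uw ->]|C [Cr [T CT Cmax]]].
- rewrite PhiE //; split; first exact: Y_resolving.
  exists T => [|C Cr CT YC]; first exact: Y_cogenerator.
  by apply/funext => M; apply/propext; split=> [|/YC //]; exact: sub.
- rewrite !PhiE // => YTU; have UT := Y_eq_finsummand nR Tw Uw YTU.
  have TU := Y_eq_finsummand nR Uw Tw (esym YTU).
  apply/funext => M; apply/propext; split=> /simP [a b]; apply/simP; split.
  + exact: finsummand_trans a TU.
  + exact: finsummand_trans UT b.
  + exact: finsummand_trans a UT.
  + exact: finsummand_trans TU b.
- have Tw := cogenerator_wakamatsu nR Cr CT.
  exists (sim_class T); first by exists T.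
  (* [Y T] contains [C] and has the same cogenerator, so the maximality of [C] forces equality. *)
  rewrite PhiE //; apply: Cmax; [exact: Y_resolving|exact: Y_cogenerator|].
  by move=> M; exact: sub.
Qed.
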